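(* Let $p$ be a prime, let $S$ be a finite $p$-group and let $\mathcal{F}$ be a fusion system on $S$. Then $\mathcal{F}$ is saturated if and only if there exists a characteristic element for $\mathcal{F}$ in $A(S,S)_{(p)}$.
   Context: **Fusion systems.** Write $c_g(x)=gxg^{-1}$. A fusion system $\mathcal{F}$ on a finite $p$-group $S$ is a category whose objects are the subgroups of $S$ and whose morphism sets $\mathrm{Hom}_{\mathcal{F}}(P,Q)$ are sets of injective group homomorphisms $P\to Q$, with the usual composition, such that (1) every $c_x|_P:P\to Q$ with $x\in S$, $xPx^{-1}\le Q$, is in $\mathrm{Hom}_{\mathcal{F}}(P,Q)$; (2) for $\varphi\in\mathrm{Hom}_{\mathcal{F}}(P,Q)$ the induced isomorphism $P\to\varphi(P)$ and its inverse are morphisms in $\mathcal{F}$. Subgroups $P,Q$ are $\mathcal{F}$-conjugate if there is an isomorphism $P\to Q$ in $\mathcal{F}$. $P$ is fully $\mathcal{F}$-centralized (resp. fully $\mathcal{F}$-normalized) if $|C_S(P)|\ge|C_S(Q)|$ (resp. $|N_S(P)|\ge|N_S(Q)|$) for all $Q$ that are $\mathcal{F}$-conjugate to $P$. $\mathrm{Aut}_S(P)$ is the group of automorphisms of $P$ induced by conjugation by elements of $N_S(P)$. $\mathcal{F}$ is saturated if: (I) if $P\le S$ is fully $\mathcal{F}$-normalized, then $P$ is fully $\mathcal{F}$-centralized and $\mathrm{Aut}_S(P)$ is a Sylow $p$-subgroup of $\mathrm{Aut}_{\mathcal{F}}(P)$; (II) if $\varphi\in\mathrm{Hom}_{\mathcal{F}}(P,S)$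 and $\varphi(P)$ is fully $\mathcal{F}$-centralized, then $\varphi$ extends to some $\overline\varphi\in\mathrm{Hom}_{\mathcal{F}}(N_\varphi,S)$, where $N_\varphi=\{x\in N_S(P)\mid \exists y\in N_S(\varphi(P)):\ \varphi(xux^{-1})=y\varphi(u)y^{-1}\ \forall u\in P\}$. **Burnside modules.** For finite groups $G,H$, a $(G,H)$-biset is a finite set with commuting right $G$-action and left $H$-action; it is left-free if $H$ acts freely. $A(G,H)$ is the Grothendieck group (under disjoint union) of isomorphism classes of finite left-free $(G,H)$-bisets. For $K\le G$ and a homomorphism $\varphi:K\to H$, $[K,\varphi]=[K,\varphi]_G^H\in A(G,H)$ is the class of $(H\times G)/\sim$ where $(x\varphi(k),y)\sim(x,ky)$ for $k\in K$. These classes form a $\mathbb{Z}$-basis, one for each $H\times G$-conjugacy class of graphs $\Delta(K,\varphi)=\{(\varphi(k),k)\mid k\in K\}$. Composition $A(H,L)\times A(G,H)\to A(G,L)$ is the bilinear map with $[X]\circ[Y]=[X\times_H Y]$. $A(G,H)_{(p)}=A(G,H)\otimes\mathbb{Z}_{(p)}$. The augmentation $\epsilon:A(S,S)_{(p)}\to\mathbb{Z}_{(p)}$ is the linear map with $\epsilon([X])=|S\backslash X|$, so $\epsilon([P,\varphi])=|S|/|P|$. ''incl'' denotes an inclusion map. **Characteristic elements.** $X\in A(S,S)_{(p)}$ is $\mathcal{F}$-generated if it lies in the $\mathbb{Z}_{(p)}$-span of the elements $[P,\varphi]_S^S$ with $P\le S$ and $\varphi\in\mathrm{Hom}_{\mathcal{F}}(P,S)$.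 $X$ is right $\mathcal{F}$-stable if $X\circ[P,\varphi]_P^S=X\circ[P,\mathrm{incl}]_P^S$ in $A(P,S)_{(p)}$ for all $P\le S$ and $\varphi\in\mathrm{Hom}_{\mathcal{F}}(P,S)$; left $\mathcal{F}$-stable if $[\varphi(P),\varphi^{-1}]_S^P\circ X=[P,\mathrm{id}]_S^P\circ X$ in $A(S,P)_{(p)}$ for all such $P,\varphi$. A (fully) characteristic element for $\mathcal{F}$ is an $\Omega\in A(S,S)_{(p)}$ that is $\mathcal{F}$-generated, both left and right $\mathcal{F}$-stable, and has $\epsilon(\Omega)$ not divisible by $p$. *)

(* Defs.v *)
From HB Require Import structures.
From mathcomp Require Import all_boot all_order all_algebra.
From mathcomp Require Import all_fingroup all_solvable.
From mathcomp Require Import boolp.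
From mathcomp Require Import freeg.

Set Implicit Arguments.
Unset Strict Implicit.
Unset Printing Implicit Defensive.

Import Order.TTheory GRing.Theory Num.Theory.

Local Open Scope ring_scope.
Local Open Scope quotient_scope.

Local Notation repr := generic_quotient.repr.

Section Zlocal.

(* [coprime] instead of "p does not divide the denominator" makes this a
   subring of [rat] for every [p]; the two agree when [p] is prime. *)
Definition Zlocal_pred (p : nat) : {pred rat} :=
  fun x => coprime p `|denq x|.

Variable p : nat.

Lemma Zlocal_predP (x : rat) :
  reflect (exists a : int, exists2 d : nat, coprime p d &
             (d != 0)%N /\ x = a%:~R / d%:R)
          (x \in Zlocal_pred p).
Proof.
apply: (iffP idP) => [xp | [a [d cpd [d0 ->]]]].
  exists (numq x), `|denq x|%N => //; split; first by rewrite absz_eq0 denq_neq0.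
  by rewrite pmulrn absz_denq divq_num_den.
rewrite unfold_in -[d%:R]/(d%:~R).
have [->|a0] := eqVneq a 0; first by rewrite mul0r; apply: coprimen1.
have := cpd; apply: coprime_dvdr.
by rewrite -[X in (_ %| X)%N](absz_nat d);
  case: (divqP a d%:Z) => [/eqP|k q _];
  rewrite ?eqz_nat ?(negPf d0) // abszM dvdn_mull.
Qed.

Fact Zlocal_subring_closed : GRing.subring_closed (Zlocal_pred p).
Proof.
split=> [|x y|x y].
- exact: coprimen1.
- move=> /Zlocal_predP[a [d cd [d0 ->]]] /Zlocal_predP[b [e ce [e0 ->]]].
  apply/Zlocal_predP; exists (a * e%:Z - b * d%:Z), (d * e)%N.
    by rewrite coprimeMr cd.
  split; first by rewrite muln_eq0 negb_or d0.
  rewrite natrM rmorphB /= !rmorphM /= mulrBl.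
  have dq : (d%:R : rat) != 0 by rewrite pnatr_eq0.
  have eq : (e%:R : rat) != 0 by rewrite pnatr_eq0.
  congr (_ - _); first by rewrite -mulf_div divff // mulr1.
  by rewrite [_ * e%:R]mulrC -mulf_div divff // mulr1.
- move=> /Zlocal_predP[a [d cd [d0 ->]]] /Zlocal_predP[b [e ce [e0 ->]]].
  apply/Zlocal_predP; exists (a * b), (d * e)%N; first by rewrite coprimeMr cd.
  split; first by rewrite muln_eq0 negb_or d0.
  by rewrite natrM rmorphM /= mulf_div.
Qed.

HB.instance Definition _ :=
  GRing.isSubringClosed.Build rat (Zlocal_pred p) Zlocal_subring_closed.

Record Zlocal : Type :=
  MkZlocal { Zlocal_val : rat; Zlocal_valP : Zlocal_val \in Zlocal_pred p }.

HB.instance Definition _ := [isSub for Zlocal_val].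
HB.instance Definition _ := [Choice of Zlocal by <:].
HB.instance Definition _ := [SubChoice_isSubComNzRing of Zlocal by <:].

End Zlocal.

Section Span.

Variables (R : nzRingType) (V : lmodType R) (B : V -> Prop).

Definition in_span (v : V) : Prop :=
  exists n (c : 'I_n -> R) (b : 'I_n -> V),
    (forall i, B (b i)) /\ v = \sum_i c i *: b i.

Lemma in_span_gen v : B v -> in_span v.
Proof.
move=> Bv; exists 1%N, (fun=> 1), (fun=> v); split=> //.
by rewrite big_ord1 scale1r.
Qed.

Lemma in_span0 : in_span 0.
Proof.
by exists 0%N, (fun=> 0), (fun=> 0); split=> [[]|] //; rewrite big_ord0.
Qed.

Lemma in_spanD u v : in_span u -> in_span v -> in_span (u + v).
Proof.
move=> [m [c [b [Bb ->]]]] [n [d [e [Be ->]]]].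
pose F (T : Type) (f : 'I_m -> T) (g : 'I_n -> T) (i : 'I_(m + n)) :=
  match fintype.split i with inl j => f j | inr j => g j end.
exists (m + n)%N, (F _ c d), (F _ b e); split=> [i|].
  by rewrite /F; case: fintype.split.
rewrite big_split_ord /=; congr (_ + _); apply: eq_bigr => i _; rewrite /F.
  by rewrite -[lshift _ _]/(unsplit (inl i)) unsplitK.
by rewrite -[rshift _ _]/(unsplit (inr i)) unsplitK.
Qed.

Lemma in_spanZ a v : in_span v -> in_span (a *: v).
Proof.
move=> [m [c [b [Bb ->]]]]; exists m, (fun i => a * c i), b; split=> //.
by rewrite scaler_sumr; apply: eq_bigr => i _; rewrite scalerA.
Qed.

Lemma in_spanN v : in_span v -> in_span (- v).
Proof. by rewrite -scaleN1r; apply: in_spanZ. Qed.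

End Span.

(* For a commutative monoid [M], [groth R M] is the [R]-module with generators
   [x], x in M, and relations [x + y] = [x] + [y].  It is the Grothendieck
   group of M for R = Z, and the extension of scalars M (x)_Z R when M is an
   abelian group. *)
Section Grothendieck.

Variables (R : nzRingType) (M : nmodType).

Local Notation free := {freeg M / R}.

Definition groth_rel (u : free) : Prop :=
  exists x y : M, u = Freeg [:: (1, x + y)] - Freeg [:: (1, x)] - Freeg [:: (1, y)].

Definition groth_eq : rel free := fun u v => `[< in_span groth_rel (u - v) >].

Fact groth_eq_refl : reflexive groth_eq.
Proof. by move=> u; apply/asboolP; rewrite subrr; apply: in_span0. Qed.

Fact groth_eq_sym : symmetric groth_eq.
Proof.
by move=> u v; apply/asboolP/asboolP => /in_spanN; rewrite opprB.
Qed.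

Fact groth_eq_trans : transitive groth_eq.
Proof.
move=> v u w /asboolP uv /asboolP vw; apply/asboolP.
by have := in_spanD uv vw; rewrite addrA subrK.
Qed.

Canonical groth_equiv :=
  EquivRel groth_eq groth_eq_refl groth_eq_sym groth_eq_trans.

Definition groth : Type := {eq_quot groth_equiv}.

HB.instance Definition _ := Quotient.on groth.
HB.instance Definition _ := Choice.on groth.

Definition groth_pi (u : free) : groth := \pi_groth u.

Lemma groth_piP u v : groth_pi u = groth_pi v <-> in_span groth_rel (u - v).
Proof.
split=> [/eqmodP/asboolP // | uv].
by apply/eqmodP/asboolP.
Qed.

Lemma groth_reprK x : groth_pi (repr x) = x.
Proof. exact: reprK. Qed.

Lemma groth_pi_repr u : in_span groth_rel (repr (groth_pi u) - u).
Proof. by apply/groth_piP; rewrite groth_reprK. Qed.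

Definition groth_zero : groth := groth_pi 0.
Definition groth_add (x y : groth) : groth := groth_pi (repr x + repr y).
Definition groth_opp (x : groth) : groth := groth_pi (- repr x).
Definition groth_scale (a : R) (x : groth) : groth := groth_pi (a *: repr x).

Lemma groth_piD u v : groth_pi (u + v) = groth_add (groth_pi u) (groth_pi v).
Proof.
apply/esym/groth_piP; rewrite opprD addrACA.
exact: in_spanD (groth_pi_repr _) (groth_pi_repr _).
Qed.

Lemma groth_piN u : groth_pi (- u) = groth_opp (groth_pi u).
Proof. by apply/esym/groth_piP; rewrite -opprD; apply/in_spanN/groth_pi_repr. Qed.

Lemma groth_piZ a u : groth_pi (a *: u) = groth_scale a (groth_pi u).
Proof. by apply/esym/groth_piP; rewrite -scalerBr; apply/in_spanZ/groth_pi_repr. Qed.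

Lemma groth_ind (P : groth -> Prop) : (forall u, P (groth_pi u)) -> forall x, P x.
Proof. by move=> Pu x; rewrite -(groth_reprK x). Qed.

Fact groth_addA : associative groth_add.
Proof. by do 3!elim/groth_ind=> ?; rewrite -!groth_piD addrA. Qed.
Fact groth_addC : commutative groth_add.
Proof. by do 2!elim/groth_ind=> ?; rewrite -!groth_piD addrC. Qed.
Fact groth_add0 : left_id groth_zero groth_add.
Proof. by elim/groth_ind=> ?; rewrite -!groth_piD add0r. Qed.
Fact groth_addN : left_inverse groth_zero groth_opp groth_add.
Proof. by elim/groth_ind=> ?; rewrite -groth_piN -!groth_piD addNr. Qed.

HB.instance Definition _ :=
  GRing.isZmodule.Build groth groth_addA groth_addC groth_add0 groth_addN.

Fact groth_scaleA a b x : groth_scale a (groth_scale b x) = groth_scale (a * b) x.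
Proof. by elim/groth_ind: x => u; rewrite -!groth_piZ scalerA. Qed.
Fact groth_scale1 : left_id 1 groth_scale.
Proof. by elim/groth_ind=> u; rewrite -!groth_piZ scale1r. Qed.
Fact groth_scaleDr : right_distributive groth_scale +%R.
Proof.
move=> a; elim/groth_ind=> u; elim/groth_ind=> v.
by rewrite -[_ + _]groth_piD -!groth_piZ -[RHS]groth_piD scalerDr.
Qed.
Fact groth_scaleDl x : {morph groth_scale^~ x : a b / a + b}.
Proof.
move=> a b; elim/groth_ind: x => u.
by rewrite -!groth_piZ -[RHS]groth_piD scalerDl.
Qed.

HB.instance Definition _ :=
  GRing.Zmodule_isLmodule.Build R groth
    groth_scaleA groth_scale1 groth_scaleDr groth_scaleDl.

Definition groth_in (x : M) : groth := groth_pi (Freeg [:: (1, x)]).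

Lemma groth_inD : {morph groth_in : x y / x + y}.
Proof.
move=> x y; apply: etrans (groth_piD _ _); apply/groth_piP/in_span_gen.
by exists x, y; rewrite opprD addrA.
Qed.

Variable L : lmodType R.

(* The linear map with [x] |-> f x; only meaningful if f is additive. *)
Definition groth_lift (f : M -> L) (x : groth) : L := fglift f (repr x).

Section LiftTheory.

Variable f : M -> L.
Hypothesis fD : {morph f : x y / x + y}.

Lemma fglift_linear (g : M -> L) a u v :
  fglift g (a *: u + v) = a *: fglift g u + fglift g v.
Proof.
have gB := @lift_is_additive R M L g.
have g0 : fglift g 0 = 0 by rewrite -[in LHS](subrr 0) gB subrr.
have gN w : fglift g (- w) = - fglift g w by rewrite -[in LHS]sub0r gB g0 sub0r.
have gD w z : fglift g (w + z) = fglift g w + fglift g z.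
  by rewrite -{1}[z]opprK gB gN opprK.
have gS (r : seq M) (F : M -> free) :
    fglift g (\sum_(x <- r) F x) = \sum_(x <- r) fglift g (F x).
  exact: (big_morph _ gD g0).
rewrite gD; congr (_ + _).
rewrite -[in RHS](freeg_sumE u) [a *: u]/(fgscale a u) /fgscale !gS scaler_sumr.
by apply: eq_bigr => x _; rewrite !liftU scalerA.
Qed.

Lemma fglift_sum (g : M -> L) u :
  fglift g u = \sum_(x <- dom u) coeff x u *: g x.
Proof.
have g0 : fglift g 0 = 0.
  by have := fglift_linear g (-1) 0 0; rewrite scaler0 addr0 scaleN1r addNr.
have gD v w : fglift g (v + w) = fglift g v + fglift g w.
  by have := fglift_linear g 1 v w; rewrite !scale1r.
rewrite -{1}(freeg_sumE u) (big_morph _ gD g0).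
by apply: eq_bigr => x _; rewrite liftU.
Qed.

Lemma groth_lift_pi u : groth_lift f (groth_pi u) = fglift f u.
Proof.
have gB := @lift_is_additive R M L f.
have g0 : fglift f 0 = 0 by rewrite -[in LHS](subrr 0) gB subrr.
apply/eqP; rewrite -subr_eq0 -gB; apply/eqP.
have [n [c [b [Bb ->]]]] := groth_pi_repr u.
elim/big_ind: _ => [//|x y x0 y0|i _].
  by rewrite -[x]scale1r fglift_linear x0 y0 scaler0 addr0.
rewrite -[_ *: _]addr0 fglift_linear g0 addr0.
have [x [y ->]] := Bb i; rewrite !gB !liftU !scale1r fD.
by rewrite [f x + _]addrC addrK subrr scaler0.
Qed.

Lemma groth_lift_in x : groth_lift f (groth_in x) = f x.
Proof. by rewrite groth_lift_pi liftU scale1r. Qed.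

Lemma groth_lift_linear a x y :
  groth_lift f (a *: x + y) = a *: groth_lift f x + groth_lift f y.
Proof.
elim/groth_ind: x => u; elim/groth_ind: y => v.
rewrite -[a *: _]groth_piZ -[_ + _]groth_piD !groth_lift_pi.
exact: fglift_linear.
Qed.

End LiftTheory.
End Grothendieck.

(* The bilinear map with ([x], [y]) |-> [f x y]; only meaningful if f is
   biadditive. *)
Definition groth_lift2 (R : nzRingType) (M N P : nmodType) (f : M -> N -> P)
    (x : groth R M) (y : groth R N) : groth R P :=
  groth_lift (fun m => groth_lift (fun n => groth_in R (f m n)) y) x.

Arguments groth_lift2 R {M N P} f x y.

Section Lift2Theory.

Variables (R : comNzRingType) (M N P : nmodType) (f : M -> N -> P).
Hypothesis fDl : forall y, {morph f^~ y : x x' / x + x'}.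
Hypothesis fDr : forall x, {morph f x : y y' / y + y'}.

Let f_inDr x : {morph (fun y => groth_in R (f x y)) : y y' / y + y'}.
Proof. by move=> y y'; rewrite fDr groth_inD. Qed.

Let f_inDl y : {morph (fun x =>
    groth_lift (fun n => groth_in R (f x n)) y) : x x' / x + x'}.
Proof.
move=> x x'; elim/groth_ind: y => u; rewrite !groth_lift_pi //.
rewrite !fglift_sum -big_split; apply: eq_bigr => z _.
by rewrite fDl groth_inD scalerDr.
Qed.

Lemma groth_lift2_in x y :
  groth_lift2 R f (groth_in R x) (groth_in R y) = groth_in R (f x y).
Proof. by rewrite /groth_lift2 !groth_lift_in. Qed.

Lemma groth_lift2_linear_l y a x x' :
  groth_lift2 R f (a *: x + x') y = a *: groth_lift2 R f x y + groth_lift2 R f x' y.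
Proof. exact: groth_lift_linear. Qed.

Lemma groth_lift2_linear_r x a y y' :
  groth_lift2 R f x (a *: y + y') = a *: groth_lift2 R f x y + groth_lift2 R f x y'.
Proof.
elim/groth_ind: x => u; rewrite /groth_lift2 !groth_lift_pi //.
rewrite !fglift_sum scaler_sumr -big_split; apply: eq_bigr => z _ /=.
by rewrite groth_lift_linear // scalerDr !scalerA mulrC.
Qed.

End Lift2Theory.

Section Biset.

Variables (gT hT : finGroupType) (G : {group gT}) (H : {group hT}).

(* Left-free (G, H)-biset structures on T: G acts on the right, H on the left. *)
Record biset_on (T : Type) : Type := Biset {
  lact : subg_of H -> T -> T;
  ract : T -> subg_of G -> T;
  lact1 : forall x, lact 1%g x = x;
  lactM : forall h k x, lact (h * k)%g x = lact h (lact k x);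
  ract1 : forall x, ract x 1%g = x;
  ractM : forall x g k, ract x (g * k)%g = ract (ract x g) k;
  lractA : forall h x g, lact h (ract x g) = ract (lact h x) g;
  lact_free : forall h x, lact h x = x -> h = 1%g
}.

Definition biset_iso (T U : Type) (X : biset_on T) (Y : biset_on U) : Prop :=
  exists f : T -> U,
    [/\ bijective f, forall h x, f (lact X h x) = lact Y h (f x)
      & forall x g, f (ract X x g) = ract Y (f x) g].

Lemma biset_iso_refl T (X : biset_on T) : biset_iso X X.
Proof. by exists id; split=> //; exists id. Qed.

Lemma biset_iso_sym T U (X : biset_on T) (Y : biset_on U) :
  biset_iso X Y -> biset_iso Y X.
Proof.
case=> f [[f' fK f'K] fl fr]; exists f'; split; first by exists f.
  by move=> h x; rewrite -{1}[x]f'K -fl fK.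
by move=> x g; rewrite -{1}[x]f'K -fr fK.
Qed.

Lemma biset_iso_trans T U V
    (X : biset_on T) (Y : biset_on U) (Z : biset_on V) :
  biset_iso X Y -> biset_iso Y Z -> biset_iso X Z.
Proof.
move=> [f [bf fl fr]] [k [bk kl kr]]; exists (k \o f).
by split=> [|h x|x g] /=; rewrite ?fl ?fr //; apply: bij_comp.
Qed.

Section Transport.

Variables (T U : Type) (f : T -> U) (f' : U -> T).
Hypotheses (fK : cancel f f') (f'K : cancel f' f).
Variable X : biset_on T.

Program Definition biset_transport : biset_on U :=
  @Biset U (fun h u => f (lact X h (f' u))) (fun u g => f (ract X (f' u) g))
    _ _ _ _ _ _.
Next Obligation. by rewrite lact1 f'K. Qed.
Next Obligation. by rewrite fK lactM. Qed.
Next Obligation. by rewrite ract1 f'K. Qed.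
Next Obligation. by rewrite fK ractM. Qed.
Next Obligation. by rewrite !fK lractA. Qed.
Next Obligation.
by apply: (@lact_free _ X h (f' x)); apply: (can_inj fK); rewrite f'K.
Qed.

Lemma biset_transport_iso : biset_iso X biset_transport.
Proof.
by exists f; split=> [|h x|x g] /=; rewrite ?fK //; exists f'.
Qed.

End Transport.

Program Definition biset_empty : biset_on void :=
  @Biset void (fun _ x => x) (fun x _ => x) _ _ _ _ _ _.
Next Obligation. by []. Qed.

Program Definition biset_sum (T U : Type) (X : biset_on T) (Y : biset_on U) :
    biset_on (T + U) :=
  @Biset (T + U)
    (fun h z => match z with
                | inl x => inl (lact X h x) | inr y => inr (lact Y h y) end)
    (fun z g => match z with
                | inl x => inl (ract X x g) | inr y => inr (ract Y y g) end)
    _ _ _ _ _ _.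
Next Obligation. by case: x => x; rewrite lact1. Qed.
Next Obligation. by case: x => x; rewrite lactM. Qed.
Next Obligation. by case: x => x; rewrite ract1. Qed.
Next Obligation. by case: x => x; rewrite ractM. Qed.
Next Obligation. by case: x => x; rewrite lractA. Qed.
Next Obligation.
by case: x H0 => x [E]; apply: lact_free E.
Qed.

Lemma biset_sum_iso (T T' U U' : Type) (X : biset_on T) (X' : biset_on T')
    (Y : biset_on U) (Y' : biset_on U') :
  biset_iso X X' -> biset_iso Y Y' ->
  biset_iso (biset_sum X Y) (biset_sum X' Y').
Proof.
move=> [f [[f' fK f'K] fl fr]] [k [[k' kK k'K] kl kr]].
exists (fun z => match z with inl x => inl (f x) | inr y => inr (k y) end).
split; last 2 first.
- by move=> h [] x /=; rewrite ?fl ?kl.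
- by move=> [] x g /=; rewrite ?fr ?kr.
exists (fun z => match z with inl x => inl (f' x) | inr y => inr (k' y) end).
- by case=> x; rewrite ?fK ?kK.
- by case=> x; rewrite ?f'K ?k'K.
Qed.

Lemma biset_sumA T U V (X : biset_on T) (Y : biset_on U) (Z : biset_on V) :
  biset_iso (biset_sum X (biset_sum Y Z)) (biset_sum (biset_sum X Y) Z).
Proof.
exists (fun z => match z with inl x => inl (inl x)
        | inr (inl y) => inl (inr y) | inr (inr z) => inr z end).
split=> [|h [x|[y|z]]|[x|[y|z]] g] //.
by exists (fun z => match z with inl (inl x) => inl x
        | inl (inr y) => inr (inl y) | inr z => inr (inr z) end);
  [case=> [x|[y|z]] | case=> [[x|y]|z]].
Qed.

Lemma biset_sumC T U (X : biset_on T) (Y : biset_on U) :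
  biset_iso (biset_sum X Y) (biset_sum Y X).
Proof.
exists (fun z => match z with inl x => inr x | inr y => inl y end).
split=> [|h [x|y]|[x|y] g] //.
by exists (fun z => match z with inl x => inr x | inr y => inl y end); case.
Qed.

Lemma biset_sum0 T (X : biset_on T) :
  biset_iso (biset_sum biset_empty X) X.
Proof.
exists (fun z => match z with inl x => of_void T x | inr y => y end).
split=> [|h [[]|y]|[[]|y] g] //.
by exists inr; [case=> [[]|y] | ].
Qed.

(* Every finite biset is isomorphic to one carried by some ['I_n]. *)
Definition sbiset : Type := {n : nat & biset_on 'I_n}.

HB.instance Definition _ := gen_eqMixin sbiset.
HB.instance Definition _ := gen_choiceMixin sbiset.

Definition sbiset_eq : rel sbiset :=
  fun X Y => `[< biset_iso (projT2 X) (projT2 Y) >].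

Fact sbiset_eq_refl : reflexive sbiset_eq.
Proof. by move=> X; apply/asboolP/biset_iso_refl. Qed.

Fact sbiset_eq_sym : symmetric sbiset_eq.
Proof. by move=> X Y; apply/asboolP/asboolP => /biset_iso_sym. Qed.

Fact sbiset_eq_trans : transitive sbiset_eq.
Proof.
move=> Y X Z /asboolP XY /asboolP YZ; apply/asboolP.
exact: biset_iso_trans XY YZ.
Qed.

Canonical sbiset_equiv :=
  EquivRel sbiset_eq sbiset_eq_refl sbiset_eq_sym sbiset_eq_trans.

Definition bclass : Type := {eq_quot sbiset_equiv}.

HB.instance Definition _ := Quotient.on bclass.
HB.instance Definition _ := Choice.on bclass.

Definition biset_skel (T : finType) (X : biset_on T) : biset_on 'I_#|T| :=
  biset_transport (@enum_rankK T) (@enum_valK T) X.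

Lemma biset_skelP (T : finType) (X : biset_on T) : biset_iso X (biset_skel X).
Proof. exact: biset_transport_iso. Qed.

Definition bclass_of (T : finType) (X : biset_on T) : bclass :=
  \pi_bclass (existT (fun n => biset_on 'I_n) #|T| (biset_skel X)).

Definition brep (c : bclass) : biset_on 'I_(projT1 (repr c)) :=
  projT2 (repr c).

Lemma bclass_ofP (T U : finType) (X : biset_on T) (Y : biset_on U) :
  bclass_of X = bclass_of Y <-> biset_iso X Y.
Proof.
split=> [/eqmodP/asboolP /= iXY | iXY].
  apply: biset_iso_trans (biset_skelP X) _; apply: biset_iso_trans iXY _.
  exact/biset_iso_sym/biset_skelP.
apply/eqmodP/asboolP => /=; apply: biset_iso_trans (biset_skelP Y).
exact: biset_iso_trans (biset_iso_sym (biset_skelP X)) iXY.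
Qed.

Lemma brepK c : bclass_of (brep c) = c.
Proof.
rewrite -[RHS]reprK; apply/eqmodP/asboolP => /=.
exact/biset_iso_sym/biset_skelP.
Qed.

Lemma brep_iso (T : finType) (X : biset_on T) : biset_iso (brep (bclass_of X)) X.
Proof. by apply/bclass_ofP; rewrite brepK. Qed.

Lemma bclass_ind (P : bclass -> Prop) :
  (forall n (X : biset_on 'I_n), P (bclass_of X)) -> forall c, P c.
Proof. by move=> PX c; rewrite -(brepK c); apply: PX. Qed.

Definition bclass_zero : bclass := bclass_of biset_empty.
Definition bclass_add (c d : bclass) : bclass :=
  bclass_of (biset_sum (brep c) (brep d)).

Lemma bclass_addE (T U : finType) (X : biset_on T) (Y : biset_on U) :
  bclass_add (bclass_of X) (bclass_of Y) = bclass_of (biset_sum X Y).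
Proof. by apply/bclass_ofP; apply: biset_sum_iso; apply: brep_iso. Qed.

Fact bclass_addA : associative bclass_add.
Proof.
elim/bclass_ind=> m X; elim/bclass_ind=> n Y; elim/bclass_ind=> k Z.
by rewrite !bclass_addE; apply/bclass_ofP/biset_sumA.
Qed.

Fact bclass_addC : commutative bclass_add.
Proof.
elim/bclass_ind=> m X; elim/bclass_ind=> n Y.
by rewrite !bclass_addE; apply/bclass_ofP/biset_sumC.
Qed.

Fact bclass_add0 : left_id bclass_zero bclass_add.
Proof.
by elim/bclass_ind=> m X; rewrite !bclass_addE; apply/bclass_ofP/biset_sum0.
Qed.

HB.instance Definition _ :=
  GRing.isNmodule.Build bclass bclass_addA bclass_addC bclass_add0.

Lemma bclass_ofD (T U : finType) (X : biset_on T) (Y : biset_on U) :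
  bclass_of (biset_sum X Y) = bclass_of X + bclass_of Y.
Proof. by rewrite -bclass_addE. Qed.

Definition lorbit (T : finType) (X : biset_on T) (x : T) : {set T} :=
  [set lact X h x | h : subg_of H].

Definition norbits (T : finType) (X : biset_on T) : nat :=
  #|[set lorbit X x | x : T]|.

Lemma lorbit_refl (T : finType) (X : biset_on T) x : x \in lorbit X x.
Proof. by apply/imsetP; exists 1%g; rewrite ?lact1. Qed.

Lemma lorbit_morph (T U : finType) (X : biset_on T) (Y : biset_on U) f x :
  (forall h x, f (lact X h x) = lact Y h (f x)) ->
  f @: lorbit X x = lorbit Y (f x).
Proof. by move=> fl; rewrite -imset_comp; apply: eq_imset => h /=. Qed.

Lemma norbits_iso (T U : finType) (X : biset_on T) (Y : biset_on U) :
  biset_iso X Y -> norbits X = norbits Y.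
Proof.
case=> f [bf fl fr]; rewrite /norbits.
rewrite -(card_imset _ (imset_inj (bij_inj bf))) -imset_comp.
case: bf => f' fK f'K; apply: eq_card => A.
apply/imsetP/imsetP => [[x _ ->] | [y _ ->]].
  by exists (f x) => //=; apply: lorbit_morph.
by exists (f' y) => //=; rewrite (lorbit_morph _ fl) f'K.
Qed.

Lemma norbits_sum (T U : finType) (X : biset_on T) (Y : biset_on U) :
  norbits (biset_sum X Y) = (norbits X + norbits Y)%N.
Proof.
have iX := imset_inj (@inl_inj T U); have iY := imset_inj (@inr_inj T U).
rewrite /norbits -(card_imset _ iX) -(card_imset _ iY) -!imset_comp.
set B := imset _ _; set C := imset _ _; set D := imset _ _.
have EX x : inl @: lorbit X x = lorbit (biset_sum X Y) (inl x).
  exact: lorbit_morph.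
have EY y : inr @: lorbit Y y = lorbit (biset_sum X Y) (inr y).
  exact: lorbit_morph.
have -> : B = C :|: D.
  apply/setP=> A; rewrite inE; apply/imsetP/orP.
    case=> [[x|y] _ ->]; [left|right]; apply/imsetP.
      by exists x => //=; rewrite EX.
    by exists y => //=; rewrite EY.
  case=> /imsetP[x _ ->]; first by exists (inl x) => //=; rewrite EX.
  by exists (inr x) => //=; rewrite EY.
rewrite cardsU; suff -> : C :&: D = set0 by rewrite cards0 subn0.
apply/setP=> A; rewrite !inE; apply/andP=> -[/imsetP[x _ ->] /imsetP[y _]] /=.
move=> /setP/(_ (inl x)); rewrite imset_f ?lorbit_refl //.
by move/esym/imsetP=> -[].
Qed.

End Biset.

Arguments lact {gT hT G H T} b h x.
Arguments ract {gT hT G H T} b x g.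

(* The quotient of a set with commuting actions by an invariant equivalence
   relation modulo which the left action is free. *)
Section QuotientBiset.

Variables (gT hT : finGroupType) (G : {group gT}) (H : {group hT}).
Variables (T : finType) (e : equiv_rel T).
Variables (la : subg_of H -> T -> T) (ra : T -> subg_of G -> T).
Hypotheses (la_e : forall h x y, e x y -> e (la h x) (la h y))
           (ra_e : forall x y g, e x y -> e (ra x g) (ra y g)).
Hypotheses (la1 : forall x, la 1%g x = x)
           (laM : forall h k x, la (h * k)%g x = la h (la k x))
           (ra1 : forall x, ra x 1%g = x)
           (raM : forall x g k, ra x (g * k)%g = ra (ra x g) k)
           (lra : forall h x g, la h (ra x g) = ra (la h x) g)
           (la_free : forall h x, e (la h x) x -> h = 1%g).

Definition qcarrier : Type := {eq_quot e}.

HB.instance Definition _ := Quotient.on qcarrier.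
HB.instance Definition _ := Countable.on qcarrier.
HB.instance Definition _ : isFinite qcarrier :=
  CanIsFinite (@reprK _ qcarrier).

Definition qpi (x : T) : qcarrier := \pi_qcarrier x.

Lemma qpiP x y : qpi x = qpi y <-> e x y.
Proof. by split=> [/eqmodP | exy]; last apply/eqmodP. Qed.

Lemma qreprK q : qpi (repr q) = q.
Proof. exact: reprK. Qed.

Lemma qrepr_pi x : e (repr (qpi x)) x.
Proof. by apply/qpiP; rewrite qreprK. Qed.

Definition qlact h (q : qcarrier) : qcarrier := qpi (la h (repr q)).
Definition qract (q : qcarrier) g : qcarrier := qpi (ra (repr q) g).

Lemma qlactE h x : qlact h (qpi x) = qpi (la h x).
Proof. exact/qpiP/la_e/qrepr_pi. Qed.

Lemma qractE x g : qract (qpi x) g = qpi (ra x g).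
Proof. exact/qpiP/ra_e/qrepr_pi. Qed.

Lemma q_ind (P : qcarrier -> Prop) : (forall x, P (qpi x)) -> forall q, P q.
Proof. by move=> Px q; rewrite -(qreprK q). Qed.

Program Definition qbiset : biset_on G H qcarrier :=
  @Biset _ _ G H qcarrier qlact qract _ _ _ _ _ _.
Next Obligation. by elim/q_ind: x => x; rewrite qlactE la1. Qed.
Next Obligation. by elim/q_ind: x => x; rewrite !qlactE laM. Qed.
Next Obligation. by elim/q_ind: x => x; rewrite qractE ra1. Qed.
Next Obligation. by elim/q_ind: x => x; rewrite !qractE raM. Qed.
Next Obligation. by elim/q_ind: x => x; rewrite !(qlactE, qractE) lra. Qed.
Next Obligation.
by elim/q_ind: x H0 => x; rewrite qlactE => /qpiP/la_free.
Qed.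

Lemma qbiset_iso (U : Type) (Y : biset_on G H U) (f : T -> U) (s : U -> T) :
    (forall x y, e x y <-> f x = f y) -> cancel s f ->
    (forall h x, f (la h x) = lact Y h (f x)) ->
    (forall x g, f (ra x g) = ract Y (f x) g) ->
  biset_iso qbiset Y.
Proof.
move=> fe sK fl fr; exists (fun q => f (repr q)).
have fpi x : f (repr (qpi x)) = f x by apply/fe/qrepr_pi.
split; last 2 first.
- by move=> h; elim/q_ind=> x; rewrite /= qlactE !fpi.
- by elim/q_ind=> x g; rewrite /= qractE !fpi.
exists (fun u => qpi (s u)); last by move=> u; rewrite fpi.
by elim/q_ind=> x; apply/qpiP/fe; rewrite sK fpi.
Qed.

End QuotientBiset.

Section Transitive.

Variables (gT hT : finGroupType) (G : {group gT}) (H : {group hT}).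
Variables (K : {group gT}) (phi : {morphism K >-> hT}).

Local Notation T := (subg_of H * subg_of G)%type.

(* (x phi(k), y) ~ (x, k y) for k in K; this is only used with K <= G and
   phi(K) <= H. *)
Definition tr_rel : rel T := fun u v =>
  [exists k in K, (val u.1 == val v.1 * phi k)%g && (val v.2 == k * val u.2)%g].

Fact tr_rel_refl : reflexive tr_rel.
Proof.
by move=> [x y]; apply/existsP; exists 1%g; rewrite /= group1 morph1 mulg1 mul1g !eqxx.
Qed.

Let tr_relC u v : tr_rel u v -> tr_rel v u.
Proof.
case/existsP=> k /and3P[Kk /eqP E /eqP F]; apply/existsP; exists k^-1%g.
by rewrite E F groupV Kk morphV //= mulgK mulKg !eqxx.
Qed.

Fact tr_rel_sym : symmetric tr_rel.
Proof. by move=> u v; apply/idP/idP => /tr_relC. Qed.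

Fact tr_rel_trans : transitive tr_rel.
Proof.
move=> v u w /existsP[k /and3P[Kk /eqP Eu /eqP Ev]].
case/existsP=> l /and3P[Kl /eqP E /eqP F]; apply/existsP; exists (l * k)%g.
by rewrite groupM // morphM // Eu F Ev E !mulgA !eqxx.
Qed.

Canonical tr_equiv := EquivRel tr_rel tr_rel_refl tr_rel_sym tr_rel_trans.

Definition tr_lact (h : subg_of H) (u : T) : T := (h * u.1, u.2)%g.
Definition tr_ract (u : T) (g : subg_of G) : T := (u.1, u.2 * g)%g.

Fact tr_lact_e h u v : tr_rel u v -> tr_rel (tr_lact h u) (tr_lact h v).
Proof.
case/existsP=> k /and3P[Kk /eqP E /eqP F]; apply/existsP; exists k.
by rewrite Kk /= E F mulgA !eqxx.
Qed.

Fact tr_ract_e u v g : tr_rel u v -> tr_rel (tr_ract u g) (tr_ract v g).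
Proof.
case/existsP=> k /and3P[Kk /eqP E /eqP F]; apply/existsP; exists k.
by rewrite Kk /= E F mulgA !eqxx.
Qed.

Fact tr_lact1 u : tr_lact 1%g u = u.
Proof. by rewrite /tr_lact mul1g; case: u. Qed.
Fact tr_lactM h k u : tr_lact (h * k)%g u = tr_lact h (tr_lact k u).
Proof. by rewrite /tr_lact mulgA. Qed.
Fact tr_ract1 u : tr_ract u 1%g = u.
Proof. by rewrite /tr_ract mulg1; case: u. Qed.
Fact tr_ractM u g k : tr_ract u (g * k)%g = tr_ract (tr_ract u g) k.
Proof. by rewrite /tr_ract mulgA. Qed.
Fact tr_lractA h u g : tr_lact h (tr_ract u g) = tr_ract (tr_lact h u) g.
Proof. by []. Qed.

Fact tr_free h u : tr_rel (tr_lact h u) u -> h = 1%g.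
Proof.
case/existsP=> k /and3P[_ /= /eqP E /eqP F].
have k1 : k = 1%g by apply: (mulIg (val u.2)); rewrite mul1g -F.
move: E; rewrite k1 morph1 mulg1 => E.
by apply/val_inj/(mulIg (val u.1)); rewrite mul1g.
Qed.

Definition tr_biset : biset_on G H (qcarrier tr_equiv) :=
  qbiset tr_lact_e tr_ract_e tr_lact1 tr_lactM tr_ract1 tr_ractM
    tr_lractA tr_free.

End Transitive.

Section Composition.

Variables (gT hT lT : finGroupType).
Variables (G : {group gT}) (H : {group hT}) (L : {group lT}).

Section Tensor.

Variables (T U : finType) (X : biset_on H L T) (Y : biset_on G H U).

(* (x h, y) ~ (x, h y) for h in H *)
Definition tens_rel : rel (T * U) := fun u v =>
  [exists h : subg_of H, (u.1 == ract X v.1 h) && (v.2 == lact Y h u.2)].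

Fact tens_rel_refl : reflexive tens_rel.
Proof. by move=> u; apply/existsP; exists 1%g; rewrite ract1 lact1 !eqxx. Qed.

Let tens_relC u v : tens_rel u v -> tens_rel v u.
Proof.
case/existsP=> h /andP[/eqP E /eqP F]; apply/existsP; exists h^-1%g.
by rewrite E F -ractM -lactM mulgV mulVg ract1 lact1 !eqxx.
Qed.

Fact tens_rel_sym : symmetric tens_rel.
Proof. by move=> u v; apply/idP/idP => /tens_relC. Qed.

Fact tens_rel_trans : transitive tens_rel.
Proof.
move=> v u w /existsP[h /andP[/eqP Eu /eqP Ev]].
case/existsP=> k /andP[/eqP E /eqP F]; apply/existsP; exists (k * h)%g.
by rewrite ractM lactM Eu F Ev E !eqxx.
Qed.

Canonical tens_equiv :=
  EquivRel tens_rel tens_rel_refl tens_rel_sym tens_rel_trans.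

Definition tens_lact (l : subg_of L) (u : T * U) : T * U := (lact X l u.1, u.2).
Definition tens_ract (u : T * U) (g : subg_of G) : T * U := (u.1, ract Y u.2 g).

Fact tens_lact_e l u v : tens_rel u v -> tens_rel (tens_lact l u) (tens_lact l v).
Proof.
case/existsP=> h /andP[/eqP E /eqP F]; apply/existsP; exists h.
by rewrite /= E F lractA !eqxx.
Qed.

Fact tens_ract_e u v g : tens_rel u v -> tens_rel (tens_ract u g) (tens_ract v g).
Proof.
case/existsP=> h /andP[/eqP E /eqP F]; apply/existsP; exists h.
by rewrite /= E F lractA !eqxx.
Qed.

Fact tens_lact1 u : tens_lact 1%g u = u.
Proof. by rewrite /tens_lact lact1; case: u. Qed.
Fact tens_lactM h k u : tens_lact (h * k)%g u = tens_lact h (tens_lact k u).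
Proof. by rewrite /tens_lact lactM. Qed.
Fact tens_ract1 u : tens_ract u 1%g = u.
Proof. by rewrite /tens_ract ract1; case: u. Qed.
Fact tens_ractM u g k : tens_ract u (g * k)%g = tens_ract (tens_ract u g) k.
Proof. by rewrite /tens_ract ractM. Qed.
Fact tens_lractA h u g :
  tens_lact h (tens_ract u g) = tens_ract (tens_lact h u) g.
Proof. by []. Qed.

Fact tens_free l u : tens_rel (tens_lact l u) u -> l = 1%g.
Proof.
case/existsP=> h /andP[/= /eqP E /eqP/esym F].
by move: E; rewrite (lact_free F) ract1; apply: lact_free.
Qed.

Definition tens : biset_on G L (qcarrier tens_equiv) :=
  qbiset tens_lact_e tens_ract_e tens_lact1 tens_lactM tens_ract1 tens_ractM
    tens_lractA tens_free.

End Tensor.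

Lemma tens_iso (T T' U U' : finType)
    (X : biset_on H L T) (X' : biset_on H L T')
    (Y : biset_on G H U) (Y' : biset_on G H U') :
  biset_iso X X' -> biset_iso Y Y' -> biset_iso (tens X Y) (tens X' Y').
Proof.
move=> [f [[f' fK f'K] fl fr]] [k [[k' kK k'K] kl kr]].
apply: (@qbiset_iso _ _ _ _ _ _ _ _ _ _ _ _ _ _ _ _ _ _
  (fun u => qpi (tens_equiv X' Y') (f u.1, k u.2))
  (fun q => (f' (repr q).1, k' (repr q).2))).
- move=> [x y] [x' y']; apply: iff_trans (iff_sym (qpiP _ _ _)).
  split=> /existsP[h /andP[/= /eqP E /eqP F]]; apply/existsP; exists h => /=.
    by rewrite E F fr kl !eqxx.
  by rewrite -(inj_eq (can_inj fK)) -(inj_eq (can_inj kK)) E F fr kl !eqxx.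
- by elim/q_ind=> u /=; rewrite f'K k'K -surjective_pairing qreprK.
- by move=> l u; rewrite [RHS]qlactE /= ?fl //; apply: tens_lact_e.
- by move=> u g; rewrite [RHS]qractE /= ?kr //; apply: tens_ract_e.
Qed.

Lemma tens_sumX (T T' U : finType)
    (X : biset_on H L T) (X' : biset_on H L T') (Y : biset_on G H U) :
  biset_iso (tens (biset_sum X X') Y) (biset_sum (tens X Y) (tens X' Y)).
Proof.
apply: (@qbiset_iso _ _ _ _ _ _ _ _ _ _ _ _ _ _ _ _ _ _
  (fun u => match u.1 with
    | inl x => inl (qpi (tens_equiv X Y) (x, u.2))
    | inr x => inr (qpi (tens_equiv X' Y) (x, u.2)) end)
  (fun q => match q with
    | inl q => (inl (repr q).1, (repr q).2)
    | inr q => (inr (repr q).1, (repr q).2) end)).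
- move=> [[x|x] y] [[x'|x'] y'] /=; split=> //.
  + case/existsP=> h E; congr inl; apply/qpiP/existsP; exists h.
    by move: E => /=; rewrite (inj_eq (@inl_inj _ _)).
  + move=> -[] /qpiP/existsP[h E]; apply/existsP; exists h.
    by move: E => /=; rewrite (inj_eq (@inl_inj _ _)).
  + by case/existsP=> h /andP[/eqP].
  + by case/existsP=> h /andP[/eqP].
  + case/existsP=> h E; congr inr; apply/qpiP/existsP; exists h.
    by move: E => /=; rewrite (inj_eq (@inr_inj _ _)).
  + move=> -[] /qpiP/existsP[h E]; apply/existsP; exists h.
    by move: E => /=; rewrite (inj_eq (@inr_inj _ _)).
- by case=> q /=; rewrite -surjective_pairing qreprK.
- by move=> l [[x|x] y] /=; rewrite qlactE //; apply: tens_lact_e.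
- by move=> [[x|x] y] g /=; rewrite qractE //; apply: tens_ract_e.
Qed.

Lemma tens_sumY (T U U' : finType)
    (X : biset_on H L T) (Y : biset_on G H U) (Y' : biset_on G H U') :
  biset_iso (tens X (biset_sum Y Y')) (biset_sum (tens X Y) (tens X Y')).
Proof.
apply: (@qbiset_iso _ _ _ _ _ _ _ _ _ _ _ _ _ _ _ _ _ _
  (fun u => match u.2 with
    | inl y => inl (qpi (tens_equiv X Y) (u.1, y))
    | inr y => inr (qpi (tens_equiv X Y') (u.1, y)) end)
  (fun q => match q with
    | inl q => ((repr q).1, inl (repr q).2)
    | inr q => ((repr q).1, inr (repr q).2) end)).
- move=> [x [y|y]] [x' [y'|y']] /=; split=> //.
  + case/existsP=> h E; congr inl; apply/qpiP/existsP; exists h.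
    by move: E => /=; rewrite (inj_eq (@inl_inj _ _)).
  + move=> -[] /qpiP/existsP[h E]; apply/existsP; exists h.
    by move: E => /=; rewrite (inj_eq (@inl_inj _ _)).
  + by case/existsP=> h /andP[_ /eqP].
  + by case/existsP=> h /andP[_ /eqP].
  + case/existsP=> h E; congr inr; apply/qpiP/existsP; exists h.
    by move: E => /=; rewrite (inj_eq (@inr_inj _ _)).
  + move=> -[] /qpiP/existsP[h E]; apply/existsP; exists h.
    by move: E => /=; rewrite (inj_eq (@inr_inj _ _)).
- by case=> q /=; rewrite -surjective_pairing qreprK.
- by move=> l [x [y|y]] /=; rewrite qlactE //; apply: tens_lact_e.
- by move=> [x [y|y]] g /=; rewrite qractE //; apply: tens_ract_e.
Qed.

Definition bclass_comp (c : bclass H L) (d : bclass G H) : bclass G L :=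
  bclass_of (tens (brep c) (brep d)).

Lemma bclass_compE (T U : finType) (X : biset_on H L T) (Y : biset_on G H U) :
  bclass_comp (bclass_of X) (bclass_of Y) = bclass_of (tens X Y).
Proof. by apply/bclass_ofP; apply: tens_iso; apply: brep_iso. Qed.

Lemma bclass_compDl d : {morph bclass_comp^~ d : c c' / c + c'}.
Proof.
elim/bclass_ind: d => k Y; elim/bclass_ind=> m X; elim/bclass_ind=> n X'.
rewrite -bclass_ofD !bclass_compE -bclass_ofD.
exact/bclass_ofP/tens_sumX.
Qed.

Lemma bclass_compDr c : {morph bclass_comp c : d d' / d + d'}.
Proof.
elim/bclass_ind: c => k X; elim/bclass_ind=> m Y; elim/bclass_ind=> n Y'.
rewrite -bclass_ofD !bclass_compE -bclass_ofD.
exact/bclass_ofP/tens_sumY.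
Qed.

End Composition.

Section Burnside.

Variables (gT hT : finGroupType) (G : {group gT}) (H : {group hT}).

(* A(G, H) *)
Definition burnside : lmodType int := groth int (bclass G H).

Variable p : nat.

(* A(G, H) (x) Z_(p) *)
Definition burnside_loc : lmodType (Zlocal p) := groth (Zlocal p) burnside.

Definition bloc_of (T : finType) (X : biset_on G H T) : burnside_loc :=
  groth_in (Zlocal p) (groth_in int (bclass_of X) : burnside).

(* [K, phi]_G^H *)
Definition bloc_tr (K : {group gT}) (phi : {morphism K >-> hT}) : burnside_loc :=
  bloc_of (tr_biset G H phi).

(* The linear map [X] |-> |H \ X|; see [augmentation_of]. *)
Definition int_augmentation : burnside -> int^o :=
  groth_lift (fun c : bclass G H => (norbits (brep c))%:Z : int^o).

Definition augmentation : burnside_loc -> (Zlocal p)^o :=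
  groth_lift (fun x : burnside => (int_augmentation x)%:~R : (Zlocal p)^o).

Let norbitsD : {morph (fun c : bclass G H => (norbits (brep c))%:Z : int^o) :
  c d / c + d}.
Proof.
elim/bclass_ind=> m X; elim/bclass_ind=> n Y.
rewrite -bclass_ofD -PoszD -norbits_sum; congr Posz; apply: norbits_iso.
apply: biset_iso_trans (brep_iso _) _.
by apply: biset_sum_iso; apply/biset_iso_sym/brep_iso.
Qed.

Let int_augmentationD :
  {morph (fun x : burnside => (int_augmentation x)%:~R : (Zlocal p)^o) :
    x y / x + y}.
Proof.
move=> x y; rewrite /int_augmentation -[x]scale1r.
by rewrite groth_lift_linear // !scale1r rmorphD.
Qed.

Lemma augmentation_of (T : finType) (X : biset_on G H T) :
  augmentation (bloc_of X) = (norbits X)%:R.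
Proof.
rewrite /augmentation groth_lift_in // /int_augmentation groth_lift_in //.
by rewrite -pmulrn (norbits_iso (brep_iso X)).
Qed.

Lemma augmentation_linear a x y :
  augmentation (a *: x + y) = a * augmentation x + augmentation y.
Proof. exact: groth_lift_linear. Qed.

End Burnside.

Section BurnsideComposition.

Variables (p : nat) (gT hT lT : finGroupType).
Variables (G : {group gT}) (H : {group hT}) (L : {group lT}).

(* The bilinear map with [X] o [Y] = [X x_H Y]; see [bloc_comp_of]. *)
Definition int_comp : burnside H L -> burnside G H -> burnside G L :=
  groth_lift2 int (@bclass_comp _ _ _ G H L).

Definition bloc_comp :
    burnside_loc H L p -> burnside_loc G H p -> burnside_loc G L p :=
  groth_lift2 (Zlocal p) int_comp.

Let int_compDl y : {morph int_comp^~ y : x x' / x + x'}.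
Proof.
move=> x x'; rewrite /int_comp -[x]scale1r.
by rewrite groth_lift2_linear_l ?scale1r //;
  first [exact: bclass_compDl | exact: bclass_compDr].
Qed.

Let int_compDr x : {morph int_comp x : y y' / y + y'}.
Proof.
move=> y y'; rewrite /int_comp -[y]scale1r.
by rewrite groth_lift2_linear_r ?scale1r //;
  first [exact: bclass_compDl | exact: bclass_compDr].
Qed.

Lemma bloc_comp_of (T U : finType) (X : biset_on H L T) (Y : biset_on G H U) :
  bloc_comp (bloc_of p X) (bloc_of p Y) = bloc_of p (tens X Y).
Proof.
rewrite /bloc_comp groth_lift2_in // /int_comp groth_lift2_in.
- by rewrite bclass_compE.
- exact: bclass_compDl.
- exact: bclass_compDr.
Qed.

Lemma bloc_comp_linear_l y a x x' :
  bloc_comp (a *: x + x') y = a *: bloc_comp x y + bloc_comp x' y.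
Proof. exact: groth_lift2_linear_l. Qed.

Lemma bloc_comp_linear_r x a y y' :
  bloc_comp x (a *: y + y') = a *: bloc_comp x y + bloc_comp x y'.
Proof. exact: groth_lift2_linear_r. Qed.

End BurnsideComposition.

(* A morphism P -> Q is a [{morphism P >-> gT}] up to equality on P
   ([fhom_ext]).  Since [u ^ x = x^-1 * u * x], the map c_x is conjugation by
   [x^-1] in the sense of the library. *)
Record fusion_system (gT : finGroupType) (S : {group gT}) : Type := FusionSystem {
  fhom : forall P Q : {group gT}, pred {morphism P >-> gT};
  fhom_sub : forall (P Q : {group gT}) (phi : {morphism P >-> gT}),
    fhom Q phi -> P \subset S /\ Q \subset S;
  fhom_injm : forall (P Q : {group gT}) (phi : {morphism P >-> gT}),
    fhom Q phi -> ('injm phi)%g;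
  fhom_im : forall (P Q : {group gT}) (phi : {morphism P >-> gT}),
    fhom Q phi -> (phi @* P)%g \subset Q;
  fhom_ext : forall (P Q : {group gT}) (phi psi : {morphism P >-> gT}),
    {in P, phi =1 psi} -> fhom Q phi -> fhom Q psi;
  fhom_id : forall P : {group gT}, P \subset S -> fhom P (idm_morphism P);
  fhom_comp : forall (P Q R : {group gT}) (phi : {morphism P >-> gT})
      (psi : {morphism Q >-> gT}) (chi : {morphism P >-> gT}),
    fhom Q phi -> fhom R psi -> {in P, chi =1 psi \o phi} -> fhom R chi;
  fhom_conj : forall (P Q : {group gT}) (x : gT),
    P \subset S -> Q \subset S -> x \in S -> (P :^ x^-1)%g \subset Q ->
    fhom Q (conjgm_morphism P x^-1);
  fhom_onto : forall (P Q : {group gT}) (phi : {morphism P >-> gT}),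
    fhom Q phi -> fhom (phi @* P)%G phi;
  fhom_inv : forall (P Q : {group gT}) (phi : {morphism P >-> gT})
      (inj_phi : ('injm phi)%g),
    fhom Q phi -> fhom P (invm_morphism inj_phi)
}.

Arguments fhom {gT S} f {P} Q phi.

Section Saturation.

Variables (gT : finGroupType) (S : {group gT}) (F : fusion_system S).
Local Open Scope group_scope.

Definition fconj (P Q : {group gT}) : Prop :=
  exists (phi : {morphism P >-> gT}) (psi : {morphism Q >-> gT}),
    [/\ fhom F Q phi, fhom F P psi, {in P, cancel phi psi}
      & {in Q, cancel psi phi}].

Definition fully_centralized (P : {group gT}) : Prop :=
  forall Q : {group gT}, fconj P Q -> (#|'C_S(Q)| <= #|'C_S(P)|)%N.

Definition fully_normalized (P : {group gT}) : Prop :=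
  forall Q : {group gT}, fconj P Q -> (#|'N_S(Q)| <= #|'N_S(P)|)%N.

Definition AutF (P : {group gT}) : {set {perm gT}} :=
  [set a in Aut P |
    `[< exists phi : {morphism P >-> gT}, fhom F P phi /\ {in P, phi =1 a} >]].

Fact AutF_group_set (P : {group gT}) : P \subset S -> group_set (AutF P).
Proof.
move=> sPS; apply/group_setP; split=> [|a b].
  rewrite inE group1; apply/asboolP; exists (idm_morphism P).
  by split=> [|u _]; [apply: fhom_id | rewrite perm1].
case/setIdP=> Aa /asboolP[phi [Fphi Ephi]].
case/setIdP=> Ab /asboolP[psi [Fpsi Epsi]].
have Aab := groupM Aa Ab; rewrite inE Aab; apply/asboolP.
exists (autm_morphism Aab); split=> [|u Pu]; last by [].
apply: (fhom_comp Fphi Fpsi) => u Pu /=.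
have Ppu : phi u \in P by rewrite (subsetP (fhom_im Fphi)) // mem_morphim.
by rewrite -[LHS]/((a * b) u) permM (Epsi _ Ppu) Ephi.
Qed.

Definition AutS (P : {group gT}) : {set {perm gT}} := conj_aut P @* 'N_S(P).

Section Extender.

Variables (P : {group gT}) (phi : {morphism P >-> gT}).

(* N_phi *)
Definition extender : {set gT} :=
  [set x in 'N_S(P) | [exists y in 'N_S(phi @* P),
     [forall u in P, phi (x * u * x^-1) == y * phi u * y^-1]]].

Fact extender_group_set : group_set extender.
Proof.
have conjP x u : x \in 'N_S(P) -> u \in P -> x * u * x^-1 \in P.
  case/setIP=> _; rewrite -groupV => nPx Pu.
  have -> : x * u * x^-1 = u ^ x^-1 by rewrite conjgE invgK mulgA.
  by rewrite memJ_norm.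
apply/group_setP; split=> [|x y].
  rewrite inE group1; apply/exists_inP; exists 1; first exact: group1.
  by apply/forall_inP=> u _; rewrite invg1 !mul1g !mulg1.
move=> /setIdP[Nx /exists_inP[x' Nx' /forall_inP Ex]].
move=> /setIdP[Ny /exists_inP[y' Ny' /forall_inP Ey]].
rewrite inE groupM //=; apply/exists_inP; exists (x' * y'); first exact: groupM.
apply/forall_inP=> u Pu.
have -> : x * y * u * (x * y)^-1 = x * (y * u * y^-1) * x^-1.
  by rewrite invMg !mulgA.
by rewrite (eqP (Ex _ (conjP _ _ Ny Pu))) (eqP (Ey _ Pu)) invMg !mulgA.
Qed.

Canonical extender_group := Group extender_group_set.

End Extender.

Variable p : nat.

Definition saturated : Prop :=
  (forall P : {group gT}, P \subset S -> fully_normalized P ->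
     fully_centralized P /\ p.-Sylow(AutF P) (AutS P))
  /\
  (forall (P : {group gT}) (phi : {morphism P >-> gT}),
     fhom F S phi -> fully_centralized (phi @* P)%G ->
     exists psi : {morphism extender_group phi >-> gT},
       fhom F S psi /\ {in P, psi =1 phi}).

End Saturation.

Section Characteristic.

Variables (gT : finGroupType) (S : {group gT}) (F : fusion_system S) (p : nat).

Definition fgenerated (X : burnside_loc S S p) : Prop :=
  in_span (fun x => exists (P : {group gT}) (phi : {morphism P >-> gT}),
             fhom F S phi /\ x = bloc_tr S S p phi) X.

Definition right_stable (X : burnside_loc S S p) : Prop :=
  forall (P : {group gT}) (phi : {morphism P >-> gT}), fhom F S phi ->
    bloc_comp X (bloc_tr P S p phi) = bloc_comp X (bloc_tr P S p (idm_morphism P)).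

Definition left_stable (X : burnside_loc S S p) : Prop :=
  forall (P : {group gT}) (phi : {morphism P >-> gT}) (Fphi : fhom F S phi),
    bloc_comp (bloc_tr S P p (invm_morphism (fhom_injm Fphi))) X
    = bloc_comp (bloc_tr S P p (idm_morphism P)) X.

Definition characteristic_element (X : burnside_loc S S p) : Prop :=
  [/\ fgenerated X, left_stable X, right_stable X
    & ~ exists y : Zlocal p, augmentation X = p%:R * y].

End Characteristic.

(* Main.v *)
From HB Require Import structures.
From mathcomp Require Import all_boot all_order all_algebra.
From mathcomp Require Import all_fingroup all_solvable.
From mathcomp Require Import boolp freeg ring.
Require Import Defs.

(** An (S, S)-biset is a set with an action of S x S, and its mark at a
    subgroup D of S x S is the number of points fixed by D. Marks extend to Z_(p)-linear
    functionals on A(S,S)_(p), and by Burnside's theorem they separate its elements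
    ([marks_inj]). In these terms an F-generated element has nonzero marks only at the graphs
    Delta(Q, phi) of morphisms of F ([mark_fgenerated]), and it is left and right stable exactly
    when its mark at Delta(Q, phi) depends only on the F-conjugacy class of Q
    ([stable_class_marks], [class_marks_left], [class_marks_right]).

    The link with saturation is a congruence ([mark_sum_stab]). A p-subgroup A of S x S that
    normalizes D acts on the fixed points of D, its subgroup C of elements (s, 1) acts
    freely, and modulo p #|C| only those points count whose stabilizer in A is a complement
    of C.

    From a characteristic element to saturation. Let f(P) be the common mark at the graphs of F
    over P. For D = 1 the congruence relates f(P) times the number of morphisms from P to S to
    the augmentation, which is prime to p. As f(P) is divisible by the order of the centralizer
    of every F-conjugate of P ([mark_left_dvd]), this determines its p-part, which is the
    largest of these orders ([class_mark_valuation]). Counting the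
    morphisms from P to S by orbits of S then gives the first saturation axiom
    ([characteristic_Sylow]). For D = Delta(P, phi), with A the normalizer of D, the congruence
    shows that some complement of C containing D is a graph of F; it is the graph of an extension
    of phi to N_phi ([characteristic_extension]).

    From saturation to a characteristic element. Start with [S, id] and correct the marks at the
    graphs of F in decreasing order of their size, by adding multiples of [Q, psi]. The
    normalizer of Delta(Q, psi) can be mapped by morphisms of F into that of the diagonal of a
    fully normalized conjugate of Q ([normalizer_to_diag]), and the Cauchy-Frobenius lemma for
    these two actions shows that the correction needed has coefficients in Z_(p)
    ([mark_congruence], [stabilize_one]). The augmentation of the result is congruent modulo p
    to the index of Aut_S(S) in Aut_F(S), which is prime to p ([saturated_characteristic]). *)

Set Implicit Arguments.
Unset Strict Implicit.
Unset Printing Implicit Defensive.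

Import Order.TTheory GRing.Theory Num.Theory.

Local Open Scope ring_scope.

(** * Divisibility in Z_(p) and induction on A(G,H)_(p) *)

Section ZlocalTheory.

Variable p : nat.
Implicit Types (n : nat) (x y : Zlocal p).

Definition Zdvd n x : Prop := exists y, x = n%:R * y.

Lemma Zlocal_valE n : Zlocal_val (n%:R : Zlocal p) = n%:R.
Proof. exact: (rmorph_nat (\val : Zlocal p -> rat)). Qed.

Lemma Zlocal_mulnI n x y : (0 < n)%N -> n%:R * x = n%:R * y -> x = y.
Proof.
move=> n0 /(congr1 (\val : Zlocal p -> rat)); rewrite !rmorphM /= !Zlocal_valE.
move=> E; apply: val_inj; apply: mulfI E.
by rewrite pnatr_eq0 -lt0n.
Qed.

Lemma Zdvd_natp m : Zdvd p m%:R -> (p %| m)%N.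
Proof.
move=> [[y /= yp]] /(congr1 (\val : Zlocal p -> rat)).
rewrite rmorphM /= !Zlocal_valE => E.
have d0 : (denq y)%:~R != 0 :> rat by rewrite intr_eq0 denq_neq0.
have /eqP : (m%:Z * denq y)%:~R = (p%:Z * numq y)%:~R :> rat.
  by rewrite !intrM -!pmulrn E -{1}(divq_num_den y) mulrA divfK.
rewrite eqr_int => /eqP Ez; have : (p %| m * `|denq y|)%N.
  by rewrite -[m]absz_nat -abszM Ez abszM absz_nat dvdn_mulr.
by rewrite Gauss_dvdl.
Qed.

Lemma ZdvdD n x y : Zdvd n x -> Zdvd n y -> Zdvd n (x + y).
Proof. by move=> [a ->] [b ->]; exists (a + b); rewrite mulrDr. Qed.
Lemma ZdvdMl n x y : Zdvd n y -> Zdvd n (x * y).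
Proof. by move=> [a ->]; exists (x * a); rewrite mulrCA. Qed.

Lemma Zdvd_of_nat n m : (n %| m)%N -> Zdvd n m%:R.
Proof. by case/dvdnP=> k ->; exists k%:R; rewrite mulnC natrM. Qed.
End ZlocalTheory.

Lemma groth_piU (R : nzRingType) (M : nmodType) (c : R) (x : M) :
  groth_pi (Freeg [:: (c, x)]) = c *: groth_in R x.
Proof.
rewrite -[RHS]groth_piZ; congr groth_pi; apply/eqP/freeg_eqP=> y.
by rewrite [RHS]coeff_fgscale !coeffU mul1r.
Qed.

Lemma groth_span_ind (R : nzRingType) (M : nmodType) (P : groth R M -> Prop) :
  P 0 -> (forall a x v, P v -> P (a *: groth_in R x + v)) -> forall v, P v.
Proof.
move=> P0 PD; elim/groth_ind=> u; rewrite -(freeg_sumE u).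
elim: (dom u) => [|x s IHs]; first by rewrite big_nil.
by rewrite big_cons [groth_pi _]groth_piD groth_piU; apply: PD.
Qed.

Section BurnsideLocInduction.
Variables (gT hT : finGroupType) (G : {group gT}) (H : {group hT}) (p : nat).

(** Every identity or congruence between linear functionals on A(G,H)_(p) is thereby
    reduced to actual bisets, where it can be proved by counting points. *)
Lemma burnside_loc_ind (P : burnside_loc G H p -> Prop) :
    (forall a u v, P u -> P v -> P (a *: u + v)) ->
    (forall (T : finType) (X : biset_on G H T), P (bloc_of p X)) ->
  forall v, P v.
Proof.
move=> PD PX.
have P0 : P 0.
  pose X := biset_empty G H.
  by have := PD (-1) _ _ (PX _ X) (PX _ X); rewrite scaleN1r addNr.
elim/groth_span_ind=> // a; elim/groth_span_ind=> [|c x b IHb] v Pv.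
  suff -> : groth_in (Zlocal p) (0 : burnside G H) = 0 by rewrite scaler0 add0r.
  by apply: (@addrI _ (groth_in (Zlocal p) (0 : burnside G H)));
     rewrite -groth_inD !addr0.
pose f : burnside G H -> burnside_loc G H p := @groth_in (Zlocal p) (burnside G H).
have fD : {morph f : u v / u + v} by exact: groth_inD.
have f0 : f 0 = 0 by apply: (@addrI _ (f 0)); rewrite -fD !addr0.
have fMn u n : f (u *+ n) = n%:R *: f u.
  by elim: n => [|n IHn]; rewrite ?scale0r // !mulrS fD IHn scalerDl scale1r.
have fN u : f (- u) = - f u by apply: (@addIr _ (f u)); rewrite -fD !addNr.
have Ec u : f (c *: u) = c%:~R *: f u.
  case: c => n; first by rewrite -pmulrn -fMn -[n%:Z]intz scaler_int.
  by rewrite NegzE scaleNr fN rmorphN /= scaleNr -pmulrn -fMn -[n.+1%:Z]intz scaler_int.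
rewrite -/(f _) fD Ec scalerDr scalerA -addrA; apply: PD; last exact: IHb.
by elim/bclass_ind: x => n X; apply: PX.
Qed.
End BurnsideLocInduction.

(** * Marks of bisets *)

Section BisetAction.
Local Open Scope group_scope.
Variables (gT hT : finGroupType) (G : {group gT}) (H : {group hT}).

(** A (G, H)-biset seen as a right H x G-set, via x (h, g) = h^-1 x g. In this form the
    point stabilizers are the subgroups D of H x G such that h x = x g for (h, g) in D; for a
    left-free biset they are graphs of homomorphisms from subgroups of G to H. *)
Definition bact (T : Type) (X : biset_on G H T) (x : T) (a : hT * gT) : T :=
  lact X (subg H a.1^-1) (ract X x (subg G a.2)).

(** The domain must be restricted to H x G: outside it, subg takes the value 1 and
    is not a morphism. *)
Fact bact_is_action (T : Type) (X : biset_on G H T) : is_action (setX H G) (bact X).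
Proof.
split=> [a x y | x a b].
  have lI h : injective (lact X h).
    by apply: (can_inj (g := lact X h^-1)) => z; rewrite -lactM mulVg lact1.
  have rI g : injective (ract X ^~ g).
    by apply: (can_inj (g := ract X ^~ g^-1)) => z; rewrite -ractM mulgV ract1.
  by move=> /lI/rI.
case: a b => [h g] [k l] /setXP[Ha Ga] /setXP[Hb Gb]; rewrite /bact /= invMg.
by rewrite !subgM ?groupV // lactM ractM lractA.
Qed.

Canonical biset_action (T : Type) (X : biset_on G H T) := Action (bact_is_action X).

Lemma bactE (T : Type) (X : biset_on G H T) (x : T) h g : h \in H -> g \in G ->
  (bact X x (h, g) = x) <-> (lact X (subg H h) x = ract X x (subg G g)).
Proof.
move=> Hh Gg; rewrite /bact /=.
have -> : subg H h^-1 = (subg H h)^-1 by rewrite morphV.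
split=> [E | <-]; last by rewrite -lactM mulVg lact1.
by rewrite -{1}E -lactM mulgV lact1.
Qed.

Lemma bact_lfree (T : Type) (X : biset_on G H T) (x : T) h : h \in H ->
  bact X x (h, 1) = x -> h = 1.
Proof.
move=> Hh /(bactE X x Hh (group1 G)); rewrite morph1 ract1.
move=> E; have E1 := lact_free E; by rewrite -(subgK h Hh) E1.
Qed.

Lemma bact_iso (T U : Type) (X : biset_on G H T) (Y : biset_on G H U) f x a :
    (forall h x, f (lact X h x) = lact Y h (f x)) ->
    (forall x g, f (ract X x g) = ract Y (f x) g) ->
  f (bact X x a) = bact Y (f x) a.
Proof. by move=> fl fr; rewrite /bact fl fr. Qed.

Definition bfix (T : finType) (X : biset_on G H T) (D : {set hT * gT}) : {set T} :=
  'Fix_(biset_action X)(D).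

Lemma card_bfix_iso (T U : finType) (X : biset_on G H T) (Y : biset_on G H U) D :
  biset_iso X Y -> #|bfix X D| = #|bfix Y D|.
Proof.
case=> f [bf fl fr]; rewrite -(card_imset _ (bij_inj bf)).
have [f' fK f'K] := bf; apply: eq_card => y.
apply/imsetP/afixP => [[x /afixP Fx ->] a Da | Fy].
  by rewrite /= -(bact_iso _ _ fl fr) -[in RHS](Fx _ Da).
exists (f' y); last by rewrite f'K.
apply/afixP=> a /Fy E; apply: (can_inj fK).
by rewrite /= (bact_iso _ _ fl fr) f'K.
Qed.

Lemma card_bfix_sum (T U : finType) (X : biset_on G H T) (Y : biset_on G H U) D :
  #|bfix (biset_sum X Y) D| = (#|bfix X D| + #|bfix Y D|)%N.
Proof.
rewrite -(card_imset _ (@inl_inj T U)) -(card_imset _ (@inr_inj T U)).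
set B := imset _ _; set C := imset _ _.
have -> : bfix (biset_sum X Y) D = B :|: C.
  apply/setP=> z; rewrite [RHS]in_setU; apply/afixP/orP => [|[]].
  - case: z => x Fx; [left|right]; apply/imsetP; exists x => //.
      by apply/afixP=> a /Fx[].
    by apply/afixP=> a /Fx[].
  - by case/imsetP=> x /afixP Fx -> a /Fx /= E; congr inl.
  by case/imsetP=> x /afixP Fx -> a /Fx /= E; congr inr.
rewrite cardsU; suff -> : B :&: C = set0 by rewrite cards0 subn0.
by apply/setP=> A; rewrite !inE; apply/andP=> -[/imsetP[x _ ->] /imsetP[y _]].
Qed.

End BisetAction.

Section Marks.
Variables (gT hT : finGroupType) (G : {group gT}) (H : {group hT}).
Variables (p : nat) (D : {set hT * gT}).

Definition int_mark : burnside G H -> int^o :=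
  groth_lift (fun c : bclass G H => #|bfix (brep c) D|%:Z : int^o).

Definition mark : burnside_loc G H p -> (Zlocal p)^o :=
  groth_lift (fun x : burnside G H => (int_mark x)%:~R : (Zlocal p)^o).

Let bfixD : {morph (fun c : bclass G H => #|bfix (brep c) D|%:Z : int^o) :
  c d / c + d}.
Proof.
elim/bclass_ind=> m X; elim/bclass_ind=> n Y.
rewrite -bclass_ofD -PoszD -card_bfix_sum; congr Posz; apply: card_bfix_iso.
apply: biset_iso_trans (brep_iso _) _.
by apply: biset_sum_iso; apply/biset_iso_sym/brep_iso.
Qed.

Let int_markD :
  {morph (fun x : burnside G H => (int_mark x)%:~R : (Zlocal p)^o) : x y / x + y}.
Proof.
move=> x y; rewrite /int_mark -[x]scale1r.
by rewrite groth_lift_linear // !scale1r rmorphD.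
Qed.

Lemma mark_of (T : finType) (X : biset_on G H T) :
  mark (bloc_of p X) = #|bfix X D|%:R.
Proof.
rewrite /mark groth_lift_in // /int_mark groth_lift_in //.
by rewrite -pmulrn (card_bfix_iso _ (brep_iso X)).
Qed.

Lemma mark_linear a x y : mark (a *: x + y) = a * mark x + mark y.
Proof. exact: groth_lift_linear. Qed.

Lemma mark0 : mark 0 = 0.
Proof. by rewrite -[X in mark X](addNr 0) -scaleN1r mark_linear mulN1r addNr. Qed.

Lemma markD x y : mark (x + y) = mark x + mark y.
Proof. by rewrite -[x]scale1r mark_linear mul1r scale1r. Qed.

Lemma markZ a x : mark (a *: x) = a * mark x.
Proof. by rewrite -[a *: x]addr0 mark_linear mark0 addr0. Qed.

Lemma markB x y : mark (x - y) = mark x - mark y.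
Proof. by rewrite -scaleN1r markD markZ mulN1r. Qed.

Lemma mark_sum (I : Type) (r : seq I) (P : pred I) (F : I -> burnside_loc G H p) :
  mark (\sum_(i <- r | P i) F i) = \sum_(i <- r | P i) mark (F i).
Proof. exact: (big_morph mark markD mark0). Qed.

End Marks.

(** The left action is free, so each of its orbits has #|H| elements, and the
    mark at the trivial subgroup counts all points. *)
Lemma augmentation_card (gT hT : finGroupType) (G : {group gT}) (H : {group hT})
    p (v : burnside_loc G H p) :
  mark 1%g v = #|H|%:R * augmentation v.
Proof.
elim/burnside_loc_ind: v => [a u v IHu IHv | T X].
  by rewrite mark_linear augmentation_linear IHu IHv mulrDr mulrCA.
rewrite mark_of augmentation_of -natrM; congr _%:R.
rewrite /bfix afix1 /norbits.
have Pr : partition [set lorbit X x | x : T] [set: T].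
  apply/and3P; split.
  - rewrite /cover eqEsubset subsetT; apply/subsetP=> x _.
    by apply/bigcupP; exists (lorbit X x); [apply: imset_f | apply: lorbit_refl].
  - apply/trivIsetP=> _ _ /imsetP[x _ ->] /imsetP[y _ ->].
    apply: contraR => /pred0Pn[z /andP[/= /imsetP[h _ zx] /imsetP[k _ zy]]].
    have Ex : x = lact X (h^-1 * k)%g y.
      by rewrite lactM -zy zx -lactM mulVg lact1.
    apply/eqP/setP=> w; apply/imsetP/imsetP => -[l _ ->].
      by exists (l * (h^-1 * k))%g; rewrite // lactM -Ex.
    by exists (l * (h^-1 * k)^-1)%g; rewrite // Ex -lactM -mulgA mulVg mulg1.
  - by apply/imsetP=> -[x _ E]; have := lorbit_refl X x; rewrite -E inE.
rewrite (card_partition Pr).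
rewrite (eq_bigr (fun=> #|H|)) ?sum_nat_const 1?mulnC // => _ /imsetP[x _ ->].
rewrite card_imset; first exact: card_sub.
move=> h k E; apply/eqP; rewrite eq_mulgV1; apply/eqP.
apply: (@lact_free _ _ _ _ _ X _ (lact X k x)).
by rewrite -lactM -mulgA mulVg mulg1.
Qed.

(** * Marks separate the elements of A(G,H)_(p) *)

Section MarksEquivariant.
Local Open Scope group_scope.
Variables (aT : finGroupType) (K : {group aT}).
Variables (T U : finType) (toX : action K T) (toY : action K U).

(** A transitive set is determined by the stabilizer of one point. *)
Lemma equiv_orbits x y :
    'C_K[x | toX] = 'C_K[y | toY] ->
  exists2 f : T -> U, {in K, forall a, f (toX x a) = toY y a} &
    {in orbit toX K x &, injective f}.
Proof.
move=> E.
have act_eq a b : a \in K -> b \in K ->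
    (toX x a == toX x b) = (toY y a == toY y b).
  move=> Ka Kb.
  have st (V : finType) (to : action K V) v :
      (to v a == to v b) = (a * b^-1 \in 'C_K[v | to]).
    rewrite inE groupM ?groupV //= inE groupM ?groupV //= !inE /= sub1set inE.
    rewrite actMin ?groupV //; apply/eqP/eqP => [-> | Ev]; first by rewrite actKin.
    by rewrite -{2}Ev actKVin.
  by rewrite !st E.
pose f z := if [pick a in K | toX x a == z] is Some a then toY y a else y.
have fE : {in K, forall a, f (toX x a) = toY y a}.
  move=> a Ka; rewrite /f; case: pickP => [b /andP[Kb] | /(_ a)].
    by rewrite act_eq // => /eqP.
  by rewrite Ka eqxx.
exists f => // _ _ /orbitP[a Ka <-] /orbitP[b Kb <-].
by rewrite !fE // => /eqP; rewrite -act_eq // => /eqP.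
Qed.

(** Burnside's theorem. Remove orbits one at a time, starting with a point x whose
    stabilizer L is as large as possible. Equality of the marks at L gives a point y of the other
    set fixed by L, and the stabilizer of y cannot be larger than L: otherwise equality of the
    marks there would yield a point of the first set with a stabilizer larger than L. The map u0
    only provides values outside A. *)
Lemma marks_equiv (u0 : T -> U) (A : {set T}) (B : {set U}) :
    [acts K, on A | toX] -> [acts K, on B | toY] ->
    (forall L : {group aT}, L \subset K ->
       #|'Fix_(A | toX)(L)| = #|'Fix_(B | toY)(L)|) ->
  exists f : T -> U,
    [/\ {in A, forall x, {in K, forall a, f (toX x a) = toY (f x) a}},
        {in A &, injective f} & f @: A = B].
Proof.
have [n leAn] := ubnP #|A|; elim: n A B leAn => // n IHn A B leAn actA actB eqAB.
have [A0 | [x0 Ax0]] := set_0Vmem A.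
  exists u0; rewrite A0; split=> [x|x y|]; rewrite ?inE // imset0; apply/esym/eqP.
  have := eqAB 1%G (sub1G _); rewrite !afix1 !setIT A0 cards0 => /esym/eqP.
  by rewrite cards_eq0.
case: (arg_maxnP (fun x => #|'C_K[x | toX]|) Ax0) => x {x0 Ax0} /= Ax maxx.
have {}Ax : x \in A by [].
pose L := 'C_K[x | toX]%G.
have sLK : L \subset K by apply: subsetIl.
have inFix (V : finType) (to : action K V) (v : V) (M : {group aT}) : M \subset K ->
    (v \in 'Fix_to(M)) = (M \subset 'C_K[v | to]).
  move=> sMK; rewrite subsetI sMK; apply/afixP/subsetP => [Fv a Ma | Cv a /Cv].
    by rewrite !inE (subsetP sMK) // sub1set inE Fv /=.
  by rewrite !inE sub1set inE => /andP[_ /eqP].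
have [y] : exists y, y \in 'Fix_(B | toY)(L).
  apply/card_gt0P; rewrite -eqAB // card_gt0; apply/set0Pn; exists x.
  by rewrite in_setI Ax (inFix _ _ _ L) /=.
rewrite in_setI inFix // => /andP[By sLy].
have Exy : 'C_K[x | toX] = 'C_K[y | toY].
  apply/eqP; rewrite eqEcard sLy /=.
  have [z] : exists z, z \in 'Fix_(A | toX)('C_K[y | toY]).
    apply/card_gt0P; rewrite (eqAB ('C_K[y | toY]%G)) ?subsetIl // card_gt0.
    apply/set0Pn; exists y; rewrite in_setI By.
    by rewrite (inFix _ _ _ 'C_K[y | toY]%G) ?subsetIl /=.
  rewrite in_setI (inFix _ _ _ 'C_K[y | toY]%G) ?subsetIl // => /andP[Az /subset_leq_card].
  by move=> /leq_trans-> //; apply: maxx.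
have [g gE gI] := equiv_orbits Exy.
set Ox := orbit toX K x; set Oy := orbit toY K y.
have sOA : Ox \subset A by rewrite acts_sub_orbit.
have sOB : Oy \subset B by rewrite acts_sub_orbit.
have gO : g @: Ox = Oy.
  apply/setP=> z; apply/imsetP/orbitP => [[_ /orbitP[a Ka <-] ->] | [a Ka <-]].
    by exists a; rewrite ?gE.
  by exists (toX x a); rewrite ?gE // mem_orbit.
have geq z a : z \in Ox -> a \in K -> g (toX z a) = toY (g z) a.
  by case/orbitP=> b Kb <- Ka; rewrite -actMin // !gE ?groupM // actMin.
have eqO (M : {group aT}) : M \subset K -> #|'Fix_(Ox | toX)(M)| = #|'Fix_(Oy | toY)(M)|.
  move=> sMK; rewrite -(card_in_imset (f := g)); last first.
    by move=> z w /setIP[Oz _] /setIP[Ow _]; apply: gI.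
  apply: eq_card => z; apply/imsetP/setIP => [[w /setIP[Ow /afixP Fw] ->] | [Oz /afixP Fz]].
    rewrite -gO imset_f //; split=> //; apply/afixP=> a Ma.
    by rewrite -geq ?Fw // (subsetP sMK).
  move: Oz Fz; rewrite -gO => /imsetP[w Ow ->] Fw; exists w => //.
  rewrite in_setI Ow; apply/afixP=> a Ma; have Ka := subsetP sMK a Ma.
  apply: gI => //; last by rewrite geq // Fw.
  by rewrite (acts_act (acts_orbit _ _ _)).
have actOx : [acts K, on Ox | toX] by apply: acts_orbit.
have actOy : [acts K, on Oy | toY] by apply: acts_orbit.
have [|||M sMK|f [fe fI fA]] := IHn (A :\: Ox) (B :\: Oy).
- rewrite ltnS in leAn; apply: leq_trans leAn; apply: proper_card; apply/properP.
  by split; [apply: subsetDl | exists x => //; rewrite inE orbit_refl].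
- exact: actsD.
- exact: actsD.
- have split_fix (V : finType) (to : action K V) (E O : {set V}) : O \subset E ->
      #|'Fix_(E :\: O | to)(M)| = (#|'Fix_(E | to)(M)| - #|'Fix_(O | to)(M)|)%N.
    move=> sOE; rewrite setIDAC cardsD; congr (_ - _)%N; apply: eq_card => z.
    by rewrite !in_setI andbC andbA; case Oz: (z \in O) => //=; rewrite (subsetP sOE).
  by rewrite !split_fix // eqAB // eqO.
(* Glue the isomorphism of the removed orbits to the one given by induction. *)
pose h z := if z \in Ox then g z else f z.
have hA : {in A :\: Ox, h =1 f} by move=> z /setDP[_ /negPf Oz]; rewrite /h Oz.
have hO : {in Ox, h =1 g} by move=> z Oz; rewrite /h Oz.
have fD z : z \in A -> z \notin Ox -> f z \in B :\: Oy.
  by move=> Az Oz; rewrite -fA imset_f // inE Oz.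
exists h; split.
- move=> z Az a Ka; rewrite /h (acts_act actOx) //; case: ifPn => Oz; first exact: geq.
  by apply: fe; rewrite // inE Oz.
- move=> z w Az Aw; rewrite /h; case: ifPn => Oz; case: ifPn => Ow.
  + exact: gI.
  + move=> E; have := fD w Aw Ow; rewrite -E inE -gO imset_f //.
  + move=> E; have := fD z Az Oz; rewrite E inE -gO imset_f //.
  + by apply: fI; rewrite inE ?Oz ?Ow.
- rewrite -(setID A Ox) imsetU (setIidPr sOA) (eq_in_imset hO) (eq_in_imset hA).
  by rewrite gO fA -[in RHS](setID B Oy) (setIidPr sOB).
Qed.

End MarksEquivariant.

Section MarksDetect.
Variables (gT hT : finGroupType) (G : {group gT}) (H : {group hT}).

Lemma marks_biset_iso (T U : finType) (X : biset_on G H T) (Y : biset_on G H U) :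
    (forall L : {group hT * gT}, L \subset setX H G -> #|bfix X L| = #|bfix Y L|) ->
  biset_iso X Y.
Proof.
move=> eqXY.
have eqTU : #|T| = #|U|.
  by have := eqXY 1%G (sub1G _); rewrite /bfix !afix1 !cardsT.
have u0 (x : T) : U.
  have U0 : (0 < #|U|)%N by rewrite -eqTU; apply/card_gt0P; exists x.
  exact: (enum_val (Ordinal U0)).
have aX : [acts setX H G, on [set: T] | biset_action X].
  by apply/subsetP=> a Ka; rewrite in_setI Ka inE; apply/subsetP=> x; rewrite !inE.
have aY : [acts setX H G, on [set: U] | biset_action Y].
  by apply/subsetP=> a Ka; rewrite in_setI Ka inE; apply/subsetP=> x; rewrite !inE.
have [|f [fe fI fT]] := @marks_equiv _ (setX_group H G) _ _ _ _ u0 _ _ aX aY.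
  by move=> L sL; rewrite !setTI; apply: eqXY.
have fi : injective f by move=> x y; apply: fI; rewrite !inE.
exists f; split.
- by apply: inj_card_bij fi _; rewrite eqTU.
- move=> h x; have := fe x (in_setT x) ((val h)^-1, 1)%g.
  rewrite /= /bact /= invgK !sgvalK !morph1 !ract1; apply.
  by rewrite inE /= groupV group1 (valP h).
- move=> x g; have := fe x (in_setT x) (1, val g)%g.
  rewrite /= /bact /= invg1 !sgvalK !morph1 !lact1; apply.
  by rewrite inE /= group1 (valP g).
Qed.

Variable p : nat.

(** Differences of two bisets: the image of A(G,H) in A(G,H)_(p). *)
Definition bdiff (v : burnside_loc G H p) : Prop :=
  exists (T U : finType) (X : biset_on G H T) (Y : biset_on G H U),
    v = bloc_of p X - bloc_of p Y.

Lemma bloc_of_sum (T U : finType) (X : biset_on G H T) (Y : biset_on G H U) :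
  bloc_of p (biset_sum X Y) = bloc_of p X + bloc_of p Y.
Proof. by rewrite /bloc_of bclass_ofD !groth_inD. Qed.

Lemma bdiffD u v : bdiff u -> bdiff v -> bdiff (u + v).
Proof.
move=> [T [U [X [Y ->]]]] [T' [U' [X' [Y' ->]]]].
exists (T + T')%type, (U + U')%type, (biset_sum X X'), (biset_sum Y Y').
by rewrite !bloc_of_sum opprD addrACA.
Qed.

Lemma bdiffN v : bdiff v -> bdiff (- v).
Proof. by move=> [T [U [X [Y ->]]]]; exists U, T, Y, X; rewrite opprB. Qed.

Lemma bdiff_of (T : finType) (X : biset_on G H T) : bdiff (bloc_of p X).
Proof.
exists (T + T)%type, T, (biset_sum X X), X.
by rewrite bloc_of_sum addrK.
Qed.

Lemma bdiffMn v n : bdiff v -> bdiff (n%:R *: v).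
Proof.
move=> Bv; have B0 : bdiff 0 by rewrite -(subrr v); apply: bdiffD (bdiffN Bv).
by rewrite scaler_nat; elim: n => // n IHn; rewrite mulrS; apply: bdiffD.
Qed.

(** Common denominators: an element of A(G,H)_(p) becomes integral after
    multiplication by some integer prime to p, which is invertible in Z_(p). *)
Lemma bdiff_denominator v : exists2 d : nat, coprime p d /\ (0 < d)%N & bdiff (d%:R *: v).
Proof.
elim/burnside_loc_ind: v => [a u v [d [cd d0] Bu] [e [ce e0] Bv] | T X]; last first.
  by exists 1%N; rewrite ?coprimen1 // scale1r; apply: bdiff_of.
pose k := `|denq (Zlocal_val a)|%N.
have k0 : (0 < k)%N by rewrite absz_gt0 denq_neq0.
exists (k * (d * e))%N.
  by rewrite !coprimeMr cd ce !muln_gt0 k0 d0 e0 !andbT; split=> //; apply: Zlocal_valP.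
rewrite scalerDr; apply: bdiffD; last first.
  by rewrite mulnA natrM -scalerA; apply: bdiffMn.
have Ea : k%:R * a = (numq (Zlocal_val a))%:~R.
  have valz z : Zlocal_val (z%:~R : Zlocal p) = z%:~R.
    exact: (rmorph_int (\val : Zlocal p -> rat)).
  apply: val_inj; rewrite rmorphM /= Zlocal_valE valz.
  by rewrite pmulrn absz_denq mulrC numqE.
have -> : (k * (d * e))%:R *: (a *: u) = (numq (Zlocal_val a))%:~R *: (e%:R *: (d%:R *: u)).
  by rewrite !scalerA !natrM -Ea; congr (_ *: _); rewrite mulrAC [d%:R * _]mulrC mulrA.
case: (numq (Zlocal_val a)) => n; first by rewrite -pmulrn; do 2!apply: bdiffMn.
by rewrite NegzE rmorphN /= scaleNr -pmulrn; apply: bdiffN; do 2!apply: bdiffMn.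
Qed.

(** After clearing denominators u - v is a difference of two bisets with the same marks,
    which are isomorphic. *)
Lemma marks_inj (u v : burnside_loc G H p) :
    (forall L : {group hT * gT}, L \subset setX H G -> mark L u = mark L v) ->
  u = v.
Proof.
move=> eq_uv; apply/eqP; rewrite -subr_eq0; apply/eqP.
have [d [cd d0] [T [U [X [Y Ed]]]]] := bdiff_denominator (u - v).
have iXY : biset_iso X Y.
  apply: marks_biset_iso => L sL; have /(congr1 (mark L)) := Ed.
  rewrite markZ !markB eq_uv // subrr mulr0 !mark_of => /esym/eqP.
  rewrite subr_eq0.
  move=> /eqP/(congr1 (\val : Zlocal p -> rat)) /=; rewrite !Zlocal_valE.
  by move=> /eqP; rewrite eqr_nat => /eqP.
have E0 : d%:R *: (u - v) = 0.
  by rewrite Ed /bloc_of (proj2 (bclass_ofP _ _) iXY) subrr.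
have uP : (d%:R^-1 : rat) \in Zlocal_pred p.
  apply/Zlocal_predP; exists 1, d => //; split; first by rewrite -lt0n.
  by rewrite mul1r.
have dK : MkZlocal uP * d%:R = 1.
  apply: val_inj; rewrite rmorphM /= Zlocal_valE mulVf //.
  by rewrite pnatr_eq0 -lt0n.
by rewrite -[LHS]scale1r -dK -scalerA E0 scaler0.
Qed.
End MarksDetect.

(** * Marks of compositions with transitive bisets *)

Section Restriction.
Local Open Scope group_scope.

Lemma card_bfix_transport (gT hT gT' hT' : finGroupType)
    (G : {group gT}) (H : {group hT}) (G' : {group gT'}) (H' : {group hT'})
    (T U : finType) (X : biset_on G H T) (Y : biset_on G' H' U)
    (D : {set hT' * gT'}) (f : hT' * gT' -> hT * gT) (j : T -> U) :
    injective j -> (forall y, exists x, j x = y) ->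
    (forall x, {in D, forall d, bact Y (j x) d = j (bact X x (f d))}) ->
  #|bfix Y D| = #|bfix X (f @: D)|.
Proof.
move=> jI js jE; rewrite -(card_imset _ jI); apply: eq_card => y.
apply/afixP/imsetP => [Fy | [x /afixP Fx ->] d Dd]; last first.
  by rewrite /= jE // -[in RHS](Fx (f d)) // imset_f.
have [x Ex] := js y; exists x => //; apply/afixP=> _ /imsetP[d Dd ->].
by apply: jI; rewrite -jE // Ex; apply: Fy.
Qed.

Variables (gT hT lT : finGroupType) (p : nat).

(** X o [P, phi] is X with the right action restricted along phi: every element of
    the tensor product has a unique representative (x, [1, 1]). *)
Lemma mark_comp_tr (P : {group gT}) (H : {group hT}) (L : {group lT})
    (phi : {morphism P >-> hT}) (v : burnside_loc H L p) (D : {set lT * gT}) :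
    phi @* P \subset H -> D \subset setX L P ->
  mark D (bloc_comp v (bloc_tr P H p phi))
    = mark [set (d.1, phi d.2) | d in D] v.
Proof.
move=> sPH sDLP; elim/burnside_loc_ind: v => [a u v IHu IHv | T X].
  by rewrite bloc_comp_linear_l !mark_linear IHu IHv.
rewrite bloc_comp_of !mark_of; congr (_%:R)%R.
pose b := qpi (tr_equiv P H phi) (1, 1).
apply: (card_bfix_transport (j := fun x => qpi (tens_equiv X (tr_biset P H phi)) (x, b))).
- move=> x y /qpiP/existsP[h /andP[/= /eqP-> /eqP]].
  rewrite qlactE; last exact: tr_lact_e.
  move=> /qpiP/existsP[k /and3P[Pk /= /eqP E /eqP]]; rewrite mulg1 => k1.
  move: E; rewrite -k1 morph1 !mulg1 => h1.
  have -> : h = 1 by apply: val_inj; rewrite /= -h1.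
  by rewrite ract1.
- elim/q_ind=> -[x]; elim/q_ind=> -[s u].
  exists (ract X x (s * subg H (phi (val u)))); apply/qpiP/existsP.
  (* (x, [s, u]) = (x, s phi(u) [1, 1]) = (x s phi(u), [1, 1]) *)
  exists (s * subg H (phi (val u))); rewrite /= eqxx /= qlactE; last exact: tr_lact_e.
  apply/eqP/qpiP/existsP; exists (val u)^-1; rewrite /= groupV (valP u) /=.
  have Hu : phi (val u) \in H by rewrite (subsetP sPH) // mem_morphim // (valP u).
  by rewrite subgK // morphV ?(valP u) // !mulg1 mulgK mulVg !eqxx.
- move=> x [l g] /(subsetP sDLP)/setXP[Ll Pg].
  rewrite /bact /= qractE; last exact: tens_ract_e.
  rewrite qlactE /tens_lact /tens_ract /=; last exact: tens_lact_e.
  have Hg : phi g \in H by rewrite (subsetP sPH) // mem_morphim.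
  rewrite qractE; last exact: tr_ract_e.
  apply/esym/qpiP/existsP; exists (subg H (phi g)); rewrite /= lractA eqxx /=.
  rewrite qlactE; last exact: tr_lact_e.
  apply/eqP/qpiP/existsP; exists g^-1; rewrite /= groupV Pg /=.
  by rewrite !subgK // morphV // !mulg1 mulgV mul1g mulVg !eqxx.
Qed.

(** When theta is an isomorphism with inverse phi, [K, theta] o X is X with the left
    action restricted along phi: every element has a unique representative ([1, 1], y). *)
Lemma mark_tr_comp (G : {group gT}) (H : {group hT}) (L : {group lT})
    (K : {group hT}) (theta : {morphism K >-> lT}) (phi : {morphism L >-> hT})
    (v : burnside_loc G H p) (D : {set lT * gT}) :
    K \subset H -> phi @* L = K -> {in L, cancel phi theta} -> {in K, cancel theta phi} ->
    D \subset setX L G ->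
  mark D (bloc_comp (bloc_tr H L p theta) v)
    = mark [set (phi d.1, d.2) | d in D] v.
Proof.
move=> sKH imphi phiK thetaK sDLG; elim/burnside_loc_ind: v => [a u v IHu IHv | T X].
  by rewrite bloc_comp_linear_r !mark_linear IHu IHv.
rewrite bloc_comp_of !mark_of; congr (_%:R)%R.
have Kphi l : l \in L -> phi l \in K by move=> Ll; rewrite -imphi mem_morphim.
have Hphi l : l \in L -> phi l \in H by move=> /Kphi; apply: subsetP.
pose b := qpi (tr_equiv H L theta) (1, 1).
apply: (card_bfix_transport (j := fun x => qpi (tens_equiv (tr_biset H L theta) X) (b, x))).
- move=> x y /qpiP/existsP[h /andP[/= /eqP Eb /eqP->]].
  move: Eb; rewrite qractE; last exact: tr_ract_e.
  move=> /qpiP/existsP[k /and3P[Kk /= /eqP]]; rewrite mul1g => E.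
  have k1 : k = 1 by rewrite -[k]thetaK // -E morph1.
  rewrite k1 !mulg1 !mul1g => /eqP h1.
  have -> : h = 1 by apply: val_inj; rewrite /= h1.
  by rewrite lact1.
- elim/q_ind=> -[]; elim/q_ind=> -[l s] x.
  have Ll := valP l.
  exists (lact X (subg H (phi (val l)) * s) x); apply/qpiP/existsP.
  exists (subg H (phi (val l)) * s)^-1; rewrite /= -lactM mulVg lact1 eqxx andbT.
  rewrite qractE; last exact: tr_ract_e.
  apply/eqP/qpiP/existsP; exists (phi (val l))^-1; rewrite /= groupV Kphi //=.
  rewrite morphV ?Kphi // phiK // subgK ?Hphi // mulgV invMg mulKVg mulg1.
  by rewrite !eqxx.
- move=> x [l g] /(subsetP sDLG)/setXP[Ll Gg].
  have Lv : l^-1 \in L by rewrite groupV.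
  rewrite /bact /= qractE; last exact: tens_ract_e.
  rewrite qlactE /tens_lact /tens_ract /=; last exact: tens_lact_e.
  rewrite qlactE; last exact: tr_lact_e.
  apply/esym/qpiP/existsP; exists (subg H (phi l)); rewrite /= -lactM.
  rewrite -subgM ?groupV ?Hphi // mulgV morph1 lact1 eqxx andbT.
  rewrite qractE; last exact: tr_ract_e.
  apply/eqP/qpiP/existsP; exists (phi l); rewrite /= Kphi // phiK //=.
  by rewrite !subgK ?Hphi // !mulg1 mulVg mul1g !eqxx.
Qed.
End Restriction.

(** * Graphs and transitive bisets *)

Section Graph.
Local Open Scope group_scope.
Variables (gT hT : finGroupType) (K : {group gT}) (phi : {morphism K >-> hT}).

(** The subgroup written Delta(K, phi); it is the stabilizer of the base point of
    [K, phi], see [tr_biset_stab]. *)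
Definition graph : {set hT * gT} := [set (phi u, u) | u in K].

Lemma graphP h u : reflect (u \in K /\ h = phi u) ((h, u) \in graph).
Proof.
apply: (iffP imsetP) => [[k Kk [-> ->]] // | [Ku ->]].
by exists u.
Qed.

Fact graph_group_set : group_set graph.
Proof.
apply/group_setP; split; first by apply/graphP; rewrite morph1.
by move=> [h u] [k v] /graphP[Ku ->] /graphP[Kv ->]; apply/graphP; rewrite groupM ?morphM.
Qed.

Canonical graph_group := Group graph_group_set.

Lemma card_graph : #|graph| = #|K|.
Proof. by apply: card_in_imset => u v _ _ []. Qed.

Lemma graph_snd : snd @: graph = K.
Proof. by rewrite -imset_comp imset_id. Qed.

Lemma graph_fst : fst @: graph = phi @* K.
Proof. by rewrite -imset_comp morphimEdom. Qed.

Lemma graph_sub (G : {group gT}) (H : {group hT}) :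
  K \subset G -> phi @* K \subset H -> graph \subset setX H G.
Proof.
move=> sKG sPH; apply/subsetP=> -[h u] /graphP[Ku ->].
by rewrite inE /= (subsetP sKG) // (subsetP sPH) ?mem_morphim.
Qed.

End Graph.

Local Notation diag P := (graph (idm_morphism P)).

Section TransitiveBiset.
Local Open Scope group_scope.
Variables (gT hT : finGroupType) (G : {group gT}) (H : {group hT}).
Variables (K : {group gT}) (phi : {morphism K >-> hT}).
Hypotheses (sKG : K \subset G) (sPH : phi @* K \subset H).

Local Notation X := (tr_biset G H phi).
Local Notation base := (qpi (tr_equiv G H phi) (1, 1)).

Let bact_base h g : h \in H -> g \in G ->
  bact X base (h, g) = qpi (tr_equiv G H phi) (subg H h^-1, subg G g).
Proof.
move=> Hh Gg; rewrite /bact /= qractE; last exact: tr_ract_e.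
rewrite qlactE; last exact: tr_lact_e.
by rewrite /tr_lact /tr_ract /= mulg1 mul1g.
Qed.

Lemma tr_biset_trans y : exists2 a, a \in setX H G & bact X base a = y.
Proof.
elim/q_ind: y => -[h g]; exists ((val h)^-1, val g).
  by rewrite inE /= groupV (valP h) (valP g).
by rewrite bact_base ?groupV ?(valP h) ?(valP g) // invgK !sgvalK.
Qed.

Lemma tr_biset_stab a : a \in setX H G -> (bact X base a == base) = (a \in graph phi).
Proof.
case: a => h g /setXP[Hh Gg]; rewrite bact_base //.
apply/eqP/graphP => [/qpiP/existsP[k /and3P[Kk]] | [Kg ->]].
  rewrite /= !subgK ?groupV // mul1g => /eqP Eh /eqP/esym/eqP.
  rewrite -eq_invg_mul => /eqP Eg; split; first by rewrite -Eg groupV.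
  by rewrite -Eg morphV // -Eh invgK.
apply/qpiP/existsP; exists g^-1; rewrite groupV Kg /=.
have Hg : phi g \in H by rewrite (subsetP sPH) ?mem_morphim.
by rewrite !subgK ?groupV // morphV // mul1g mulVg !eqxx.
Qed.

Let conj_stab c d : c \in setX H G -> d \in setX H G ->
  (bact X (bact X base c) d == bact X base c) = (d ^ c^-1 \in graph phi).
Proof.
move=> Kc Kd; have act_in := actMin (biset_action X).
have Kdc : d ^ c^-1 \in setX H G by rewrite groupJ ?groupV.
rewrite -(tr_biset_stab Kdc) conjgE invgK.
have E : bact X base (c * (d * c^-1)) = bact X (bact X (bact X base c) d) c^-1.
  by rewrite mulgA -![bact X _ _]/(biset_action X _ _) !act_in ?groupM ?groupV.
rewrite E; apply/eqP/eqP => [->|{2}<-].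
  exact: (actKin (biset_action X)).
exact/esym/(actKVin (biset_action X)).
Qed.

Lemma bfix_tr_conj (D : {set hT * gT}) : D \subset setX H G -> bfix X D != set0 ->
  exists2 c, c \in setX H G & D :^ c \subset graph phi.
Proof.
move=> sD /set0Pn[y /afixP Fy]; have [c Kc Ec] := tr_biset_trans y.
exists c^-1; first by rewrite groupV.
apply/subsetP=> _ /imsetP[d Dd ->]; rewrite -(conj_stab Kc (subsetP sD _ Dd)).
by rewrite Ec; apply/eqP/Fy.
Qed.

(** The fixed points of a point stabilizer D on a transitive set form one orbit of the
    normalizer of D, on which D acts trivially. *)
Lemma card_bfix_tr :
  (#|bfix X (graph phi)| * #|graph phi|)%N = #|'N_(setX H G)(graph phi)|.
Proof.
have sgH : graph phi \subset setX H G by apply: graph_sub.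
have sgN : graph phi \subset 'N_(setX H G)(graph phi).
  by rewrite subsetI sgH normG.
have EC : 'C_('N_(setX H G)(graph phi))[base | biset_action X] = graph phi.
  apply/setP=> a; apply/setIP/idP => [[Na] | ga].
    rewrite in_setI => /andP[Ka]; rewrite inE sub1set inE.
    by rewrite [_ == _]tr_biset_stab.
  split; first exact: (subsetP sgN).
  rewrite in_setI (subsetP sgH) // inE sub1set inE.
  by rewrite [_ == _]tr_biset_stab ?(subsetP sgH).
rewrite -[X in (_ * X)%N]/#|pred_of_set (graph phi)| -[in X in (_ * X)%N]EC.
rewrite -(@card_orbit_in_stab _ _ _ (biset_action X) ('N_(setX H G)(graph phi))%G base) ?subsetIl //.
congr (_ * _)%N; apply: eq_card => y.
have [c Kc <-] := tr_biset_trans y.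
apply/afixP/orbitP => [Fc | [n Nn <-] d gd]; last first.
  have [Kn nD] := setIP Nn.
  by apply/eqP; rewrite [_ == _](conj_stab Kn (subsetP sgH _ gd)) memJ_norm ?groupV.
exists c => //; rewrite in_setI Kc -groupV; apply/normP/eqP.
rewrite eqEcard cardJg leqnn andbT; apply/subsetP=> _ /imsetP[d gd ->].
by rewrite -(conj_stab Kc (subsetP sgH _ gd)); apply/eqP/Fc.
Qed.

End TransitiveBiset.

(** * Morphisms of a fusion system and their graphs *)

Section FusionTheory.
Local Open Scope group_scope.
Variables (gT : finGroupType) (S : {group gT}) (F : fusion_system S).
Implicit Types P Q R : {group gT}.

Lemma fhom_subl P Q (phi : {morphism P >-> gT}) : fhom F Q phi -> P \subset S.
Proof. by case/fhom_sub. Qed.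

Lemma fhom_compose P Q R (phi : {morphism P >-> gT}) (psi : {morphism Q >-> gT}) :
    fhom F Q phi -> fhom F R psi ->
  exists2 chi : {morphism P >-> gT}, fhom F R chi & {in P, chi =1 psi \o phi}.
Proof.
move=> Fphi Fpsi.
have sP : P \subset phi @*^-1 Q by rewrite -sub_morphim_pre // (fhom_im Fphi).
exists (restrm_morphism sP (comp_morphism phi psi)) => //.
exact: (fhom_comp Fphi Fpsi).
Qed.

Lemma fhom_incl P Q : P \subset Q -> Q \subset S ->
  exists2 phi : {morphism P >-> gT}, fhom F Q phi & {in P, phi =1 id}.
Proof.
move=> sPQ sQS; exists (conjgm_morphism P 1^-1); last first.
  by move=> u _ /=; rewrite /conjgm invg1 conjg1.
apply: fhom_conj => //; first exact: subset_trans sQS.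
by rewrite invg1 conjsg1.
Qed.

Lemma fhom_widen P Q R (phi : {morphism P >-> gT}) :
  fhom F Q phi -> phi @* P \subset R -> R \subset S -> fhom F R phi.
Proof.
move=> Fphi sPR sRS; have [i Fi Ei] := fhom_incl sPR sRS.
apply: (fhom_comp (fhom_onto Fphi) Fi) => u Pu /=.
by rewrite Ei // mem_morphim.
Qed.

Lemma fhom_toS P Q (phi : {morphism P >-> gT}) : fhom F Q phi -> fhom F S phi.
Proof.
move=> Fphi; apply: fhom_widen (Fphi) _ _ => //.
by apply: subset_trans (fhom_im Fphi) _; case: (fhom_sub Fphi).
Qed.

Lemma fhom_imS P Q (phi : {morphism P >-> gT}) : fhom F Q phi -> phi @* P \subset S.
Proof. by move/fhom_toS/fhom_im. Qed.

Lemma fhom_restrict P Q R (phi : {morphism P >-> gT}) : R \subset P ->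
    fhom F Q phi ->
  exists2 chi : {morphism R >-> gT}, fhom F Q chi & {in R, chi =1 phi}.
Proof.
move=> sRP Fphi; have [i Fi Ei] := fhom_incl sRP (fhom_subl Fphi).
have [chi Fchi Echi] := fhom_compose Fi Fphi.
by exists chi => // u Ru; rewrite Echi //= Ei.
Qed.

Lemma fhom_inverse P Q (phi : {morphism P >-> gT}) : fhom F Q phi ->
  exists psi : {morphism phi @* P >-> gT},
    [/\ fhom F P psi, {in P, cancel phi psi}, {in phi @* P, cancel psi phi}
      & psi @* (phi @* P) = P].
Proof.
move=> Fphi; have inj := fhom_injm Fphi.
exists (invm_morphism inj); split.
- exact: (fhom_inv inj Fphi).
- by move=> u Pu; apply: invmE.
- by move=> u Pu; apply: invmK.
- exact: im_invm.
Qed.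

Lemma fconj_im P Q (phi : {morphism P >-> gT}) : fhom F Q phi -> fconj F P (phi @* P)%G.
Proof.
move=> Fphi; have [psi [Fpsi K1 K2 _]] := fhom_inverse Fphi.
by exists phi, psi; split=> //; apply: fhom_onto Fphi.
Qed.

Lemma fconjP P Q : fconj F P Q ->
  exists2 phi : {morphism P >-> gT}, fhom F Q phi & phi @* P = Q.
Proof.
case=> phi [psi [Fphi Fpsi K1 K2]]; exists phi => //.
apply/eqP; rewrite eqEsubset (fhom_im Fphi) /=; apply/subsetP=> u Qu.
have Pu : psi u \in P by rewrite (subsetP (fhom_im Fpsi)) // mem_morphim.
by rewrite -(K2 _ Qu) mem_morphim.
Qed.

Lemma fconj_refl P : P \subset S -> fconj F P P.
Proof.
by move=> sPS; exists (idm_morphism P), (idm_morphism P); split=> //; apply: fhom_id.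
Qed.

Lemma fconj_sym P Q : fconj F P Q -> fconj F Q P.
Proof. by case=> phi [psi []]; exists psi, phi. Qed.

Lemma fconj_trans P Q R : fconj F P Q -> fconj F Q R -> fconj F P R.
Proof.
case/fconjP=> phi Fphi Ephi; have {Ephi}EQ : (phi @* P)%G = Q by apply: val_inj.
subst Q => /=.
move=> /fconjP[psi Fpsi Epsi].
have [chi Fchi Echi] := fhom_compose Fphi Fpsi.
have -> : R = (chi @* P)%G; last exact: fconj_im Fchi.
apply/val_inj; rewrite /= -Epsi !morphimEdom -imset_comp setIid.
by apply: eq_in_imset => u Pu /=; rewrite Echi.
Qed.

Lemma fconj_sub P Q : fconj F P Q -> P \subset S /\ Q \subset S.
Proof. by case=> phi [psi [/fhom_sub]]. Qed.

Lemma fconj_card P Q : fconj F P Q -> #|P| = #|Q|.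
Proof. by case/fconjP=> phi Fphi <-; rewrite card_injm ?(fhom_injm Fphi). Qed.

Lemma fhom_conjg P x : P \subset S -> x \in S ->
  exists2 phi : {morphism P >-> gT}, fhom F S phi & {in P, forall u, phi u = u ^ x}.
Proof.
move=> sPS Sx; exists (conjgm_morphism P x^-1^-1); last by move=> u; rewrite invgK.
by apply: fhom_conj; rewrite ?groupV // conj_subG ?groupV.
Qed.

Lemma fconj_conjg P x : P \subset S -> x \in S -> fconj F P (P :^ x)%G.
Proof.
move=> sPS Sx; have [phi Fphi E] := fhom_conjg sPS Sx.
have -> : (P :^ x)%G = (phi @* P)%G; last exact: fconj_im Fphi.
by apply/val_inj; rewrite /= morphimEdom; apply: eq_in_imset => u /E.
Qed.

(** The image of phi is not recorded: since phi and its inverse lie in F, the class of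
    the graph under the conjugation relation of F x F depends only on the class of Q. *)
Definition fgraph (Q : {group gT}) (D : {set gT * gT}) : Prop :=
  exists2 phi : {morphism Q >-> gT}, fhom F S phi & D = graph phi.

Lemma fgraph_sub Q D : fgraph Q D -> D \subset setX S S.
Proof.
by case=> phi Fphi ->; apply: graph_sub (fhom_imS Fphi); apply: fhom_subl Fphi.
Qed.

Lemma fgraph_dom Q R D : fgraph Q D -> fgraph R D -> Q = R.
Proof.
move=> [phi _ E] [psi _ E']; apply/val_inj; rewrite /= -(graph_snd phi) -(graph_snd psi).
by rewrite -E E'.
Qed.

Lemma fgraph_card Q D : fgraph Q D -> #|D| = #|Q|.
Proof. by case=> phi _ ->; apply: card_graph. Qed.

Lemma fgraph_fhom P (phi : {morphism P >-> gT}) : fhom F S phi -> fgraph P (graph phi).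
Proof. by exists phi. Qed.

Lemma fgraph_restrict Q D (E : {group gT * gT}) : fgraph Q D -> E \subset D ->
  exists2 R : {group gT}, R \subset Q & fgraph R E.
Proof.
move=> [phi Fphi ->] sED.
have gR : group_set [set d.2 | d in E].
  apply/group_setP; split=> [|_ _ /imsetP[d Ed ->] /imsetP[e Ee ->]].
    by apply/imsetP; exists 1; rewrite ?group1.
  by apply/imsetP; exists (d * e); rewrite ?groupM.
have sRQ : Group gR \subset Q.
  by rewrite -(graph_snd phi) /= imsetS.
have [chi Fchi Echi] := fhom_restrict sRQ Fphi.
exists (Group gR) => //; exists chi => //; apply/setP=> -[h u].
apply/idP/graphP => [Ed | [/imsetP[[k v] Ed /= Eu] ->]].
  have Ru : u \in Group gR by apply/imsetP; exists (h, u).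
  split=> //; rewrite Echi //.
  by have /graphP[] := subsetP sED _ Ed.
subst u.
have /graphP[Pv Ek] := subsetP sED _ Ed.
by rewrite Echi -?Ek //; apply/imsetP; exists (k, v).
Qed.

(** (beta x alpha) carries Delta(Q, phi) to the graph of
    beta o phi o alpha^-1 on alpha(Q). *)
Lemma fgraph_map Q D (A B : {group gT}) (alpha : {morphism A >-> gT})
    (beta : {morphism B >-> gT}) :
    fgraph Q D -> D \subset setX B A -> fhom F S alpha -> fhom F S beta ->
  exists2 R, fconj F Q R & fgraph R [set (beta d.1, alpha d.2) | d in D].
Proof.
move=> [phi Fphi ->] sD Falpha Fbeta.
have sQA : Q \subset A.
  apply/subsetP=> u Qu.
  by have /setXP[] := subsetP sD (phi u, u) (introT (graphP _ _ _) (conj Qu erefl)).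
have sQB : phi @* Q \subset B.
  apply/subsetP=> _ /morphimP[u _ Qu ->].
  by have /setXP[] := subsetP sD (phi u, u) (introT (graphP _ _ _) (conj Qu erefl)).
have [a Fa Ea] := fhom_restrict sQA Falpha.
have [b [Fb K1 K2 imb]] := fhom_inverse Fa.
have FphiB : fhom F B phi by apply: fhom_widen Fphi sQB (fhom_subl Fbeta).
have [c Fc Ec] := fhom_compose Fb FphiB.
have [d Fd Ed] := fhom_compose Fc Fbeta.
exists (a @* Q)%G; first exact: fconj_im Fa.
exists d => //; apply/setP=> -[h u]; apply/imsetP/graphP.
  move=> [[k v] /graphP[Qv ->] [-> ->]]; rewrite -Ea //.
  by rewrite mem_morphim // Ed ?mem_morphim //= Ec ?mem_morphim //= K1.
move=> [/morphimP[v _ Qv ->] ->]; exists (phi v, v); first exact/graphP.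
by rewrite Ed ?mem_morphim //= Ec ?mem_morphim //= K1 // -Ea.
Qed.

Lemma fgraph_conj Q D c : fgraph Q D -> c \in setX S S ->
  exists2 R, fconj F Q R & fgraph R (D :^ c).
Proof.
case: c => s t gD /setXP[Ss St].
have [beta Fbeta Eb] := fhom_conjg (subxx S) Ss.
have [alpha Falpha Ea] := fhom_conjg (subxx S) St.
have [R QR gR] := fgraph_map gD (fgraph_sub gD) Falpha Fbeta.
exists R => //; congr fgraph: gR; apply: eq_in_imset => -[h u] Dd /=.
have /setXP[Sh Su] := subsetP (fgraph_sub gD) _ Dd.
by rewrite Ea // Eb.
Qed.

(** All point stabilizers in [P, phi] are conjugates of Delta(P, phi), and graphs
    of morphisms of F are closed under conjugation and under passing to subgroups. *)
Lemma mark_fgenerated p (v : burnside_loc S S p) (D : {group gT * gT}) :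
    fgenerated F v -> D \subset setX S S -> (mark D v != 0)%R ->
  exists Q, fgraph Q D.
Proof.
move=> [n [c [b [Bb ->]]]] sD; rewrite mark_sum => nz.
have [i] : exists i, (mark D (c i *: b i) != 0)%R.
  apply/existsP; apply: contraR nz; rewrite negb_exists => /forallP z.
  by rewrite big1 // => i _; apply/eqP; move: (z i); rewrite negbK.
rewrite markZ; have [P [phi [Fphi ->]]] := Bb i; rewrite mark_of => nzi.
have : bfix (tr_biset S S phi) D != set0.
  by apply: contraNneq nzi => ->; rewrite cards0 mulr0.
have imS := fhom_imS Fphi.
move=> /(bfix_tr_conj imS sD)[e Ke sDe].
have [R _ gR] := fgraph_restrict (E := (D :^ e)%G) (fgraph_fhom Fphi) sDe.
have Ke' : e^-1 \in setX S S by rewrite groupV.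
have [Q _ gQ] := fgraph_conj gR Ke'.
by exists Q; rewrite /= conjsgK in gQ.
Qed.

End FusionTheory.

(** * Congruences between marks from orbit counting *)

Section OrbitCounting.
Local Open Scope group_scope.
Variables (gT hT : finGroupType) (G : {group gT}) (H : {group hT}).
Variables (p : nat).
Implicit Types (A : {group hT * gT}) (D : {set hT * gT}).

Lemma acts_bfix (T : finType) (X : biset_on G H T) A D :
    A \subset setX H G -> D \subset setX H G -> A \subset 'N(D) ->
  [acts A, on bfix X D | biset_action X].
Proof.
move=> sA sD nDA; have := acts_subnorm_fix (biset_action X) D.
by rewrite (setIidPr sD); apply: subset_trans; rewrite subsetI sA.
Qed.

Lemma in_stab (T : finType) (X : biset_on G H T) A x a : A \subset setX H G ->
  (a \in 'C_A[x | biset_action X]) = (a \in A) && (bact X x a == x).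
Proof.
move=> sA; rewrite in_setI; apply: andb_id2l => Aa.
by rewrite in_setI (subsetP sA) // inE sub1set inE.
Qed.

(** Left freeness: elements (h, 1) with h <> 1 fix nothing. *)
Lemma stab_left_trivial (T : finType) (X : biset_on G H T) A x : A \subset setX H G ->
  'C_A[x | biset_action X] :&: setX H 1 = 1.
Proof.
move=> sA; apply/trivgP/subsetP=> -[h g]; rewrite in_setI in_stab //.
case/andP=> /andP[_ /eqP E] /setXP[Hh /set1P g1]; rewrite g1 in E *.
by rewrite (bact_lfree Hh E) inE.
Qed.

Lemma bfix_left_dvd (T : finType) (X : biset_on G H T) (C : {group hT * gT}) D :
    C \subset setX H 1 -> D \subset setX H G -> C \subset 'N(D) ->
  (#|C| %| #|bfix X D|)%N.
Proof.
move=> sC sD nDC; have sCG : C \subset setX H G.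
  by apply: subset_trans sC _; rewrite setXS ?sub1G.
have actC := acts_bfix X sCG sD nDC.
rewrite -(acts_sum_card_orbit actC); apply: dvdn_sum => _ /imsetP[x _ ->].
rewrite -(card_orbit_in_stab (biset_action X) x sCG) -[X in (_ %| X)%N]muln1 dvdn_pmul2l ?dvdn1; last first.
  by apply/card_gt0P; exists x; apply: orbit_refl.
rewrite -trivg_card1 -subG1 -(stab_left_trivial X x sCG) subsetI subxx.
by apply: subset_trans sC; apply: subsetIl.
Qed.

Lemma mark_left_dvd (v : burnside_loc G H p) (C : {group hT * gT}) D :
    C \subset setX H 1 -> D \subset setX H G -> C \subset 'N(D) ->
  Zdvd #|C| (mark D v).
Proof.
move=> sC sD nDC; elim/burnside_loc_ind: v => [a u v Du Dv | T X].
  by rewrite mark_linear; apply: ZdvdD Dv; apply: ZdvdMl.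
by rewrite mark_of; apply/Zdvd_of_nat/bfix_left_dvd.
Qed.

(** A acts on the fixed points of D. The stabilizer in A of a point meets
    C = A :&: (H x 1) trivially, so in the p-group A its order times #|C| divides #|A|: every
    orbit has size #|C| times a power of p. Modulo p #|C| only the points x count for which the
    stabilizer E satisfies #|E| #|C| = #|A|, and for E of this order the points with stabilizer E
    are exactly the fixed points of E. *)
Lemma bfix_sum_stab (T : finType) (X : biset_on G H T) A D :
    prime p -> p.-group A -> A \subset setX H G -> D \subset A -> A \subset 'N(D) ->
  let c := #|A :&: setX H 1| in
  exists k, #|bfix X D| = (\sum_(E : {set hT * gT} |
     [&& group_set E, D \subset E, E \subset A & (#|E| * c == #|A|)%N]) #|bfix X E| + p * c * k)%N.
Proof.
move=> p_pr pA sA sDA nDA; set C := A :&: setX H 1 => c.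
have sD := subset_trans sDA sA.
have actA := acts_bfix X sA sD nDA.
have stC x : (#|'C_A[x | biset_action X]| * c <= #|A|)%N.
  rewrite -TI_cardMg; last first.
    apply/trivgP; rewrite -(stab_left_trivial X x sA) setISS ?subsetIr //.
  by rewrite subset_leq_card // mul_subG ?subsetIl.
pose Y0 := [set x in bfix X D | (#|'C_A[x | biset_action X]| * c == #|A|)%N].
pose Y1 := bfix X D :\: Y0.
have sY0 : Y0 \subset bfix X D by apply/subsetP=> x /setIdP[].
have actY1 : [acts A, on Y1 | biset_action X].
  apply: actsD => //; apply/subsetP=> a Aa.
  rewrite in_setI (subsetP sA) // inE; apply/subsetP=> x /setIdP[Yx cx].
  rewrite 2!inE /= (acts_act actA) // Yx /=.
  have -> : 'C_A[bact X x a | biset_action X] = 'C_A[x | biset_action X] :^ a.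
    rewrite -[bact X x a]/(biset_action X x a) (astab1_act_in _ _ (subsetP sA _ Aa)).
    by rewrite [RHS]conjIg (conjGid Aa).
  by rewrite cardJg.
(* The orbits in Y1 have size #|C| times a nontrivial power of p. *)
have [k Ek] : exists k, #|Y1| = (p * c * k)%N.
  suff /dvdnP[k ->] : (p * c %| #|Y1|)%N by exists k; rewrite mulnC.
  rewrite -(acts_sum_card_orbit actY1); apply: dvdn_sum => _ /imsetP[x Y1x ->].
  have := card_orbit_in_stab (biset_action X) x sA; have := stC x.
  have pS : p.-nat #|'C_A[x | biset_action X]|.
    by apply: pnat_dvd pA; apply: cardSg; apply: subsetIl.
  have pC : p.-nat c by apply: pnat_dvd pA; apply: cardSg; apply: subsetIl.
  have pO : p.-nat #|orbit (biset_action X) A x|.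
    by apply: pnat_dvd pA; rewrite -(card_orbit_in_stab (biset_action X) x sA) dvdn_mulr.
  have neq : (#|'C_A[x | biset_action X]| * c != #|A|)%N.
    case/setDP: Y1x => Yx; apply: contra => E.
    by rewrite inE Yx E.
  move: neq; have /p_natP[s ->] := pS; have /p_natP[t ->] := pC.
  have /p_natP[o ->] := pO; have /p_natP[a ->] := pA.
  rewrite -!expnD -expnS !(inj_eq (expnI (prime_gt1 p_pr))) leq_exp2l ?prime_gt1 //.
  move=> neq le /(expnI (prime_gt1 p_pr)) E; apply: dvdn_exp2l.
  move: neq le; rewrite -E => neq le.
  have : (s + t < o + s)%N by rewrite ltn_neqAle neq.
  by rewrite [(o + s)%N]addnC ltn_add2l.
exists k; rewrite -(cardsID Y0) (setIidPr sY0) -/Y1 Ek; congr (_ + _)%N.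
rewrite -sum1_card.
(* Sort the remaining points by their stabilizers. *)
rewrite (partition_big (fun x => 'C_A[x | biset_action X])
   (fun E => [&& group_set E, D \subset E, E \subset A & (#|E| * c == #|A|)%N])) /=; last first.
  move=> x /setIdP[/afixP Fx cx]; rewrite groupP cx subsetIl !andbT /=.
  apply/subsetP=> d Dd; rewrite in_stab // (subsetP sDA) //=.
  by apply/eqP/Fx.
apply: eq_bigr => E /and4P[_ sDE sEA cE]; rewrite sum1_card; apply: eq_card => x.
rewrite -[LHS]/((x \in Y0) && ('C_A[x | biset_action X] == E)).
apply/andP/afixP => [[_ /eqP <-] d | Fx].
  by rewrite in_stab // => /andP[_ /eqP].
have sES : E \subset 'C_A[x | biset_action X].
  apply/subsetP=> e Ee; rewrite in_stab // (subsetP sEA) //=.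
  by apply/eqP/Fx.
have EC : 'C_A[x | biset_action X] = E.
  apply/esym/eqP; rewrite eqEcard sES /=.
  have c0 : (0 < c)%N by apply: (cardG_gt0 (A :&: setX H 1)%G).
  by rewrite -(leq_pmul2r c0) (eqP cE).
split; last by rewrite EC.
rewrite inE EC cE andbT; apply/afixP=> d Dd; apply: Fx; exact: (subsetP sDE).
Qed.

Lemma mark_sum_stab (v : burnside_loc G H p) A D :
    prime p -> p.-group A -> A \subset setX H G -> D \subset A -> A \subset 'N(D) ->
  let c := #|A :&: setX H 1| in
  Zdvd (p * c) (mark D v - \sum_(E : {set hT * gT} |
     [&& group_set E, D \subset E, E \subset A & (#|E| * c == #|A|)%N]) mark E v)%R.
Proof.
move=> p_pr pA sA sDA nDA c; elim/burnside_loc_ind: v => [a u v Du Dv | T X].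
  rewrite mark_linear (eq_bigr _ (fun E _ => mark_linear E a u v)) big_split /=.
  rewrite -mulr_sumr opprD addrACA -mulrBr.
  by apply: ZdvdD Dv; apply: ZdvdMl.
rewrite mark_of (eq_bigr _ (fun E _ => mark_of p E X)).
have [k ->] := bfix_sum_stab X p_pr pA sA sDA nDA.
by exists k%:R; rewrite natrD natr_sum addrAC subrr add0r natrM.
Qed.

(** The sum counts pairs of an element of A and a fixed point of D that it
    fixes; by the Cauchy-Frobenius lemma it is #|A| times the number of orbits. *)
Lemma mark_Cauchy_Frobenius (v : burnside_loc G H p) A D :
    A \subset setX H G -> D \subset setX H G -> A \subset 'N(D) ->
  Zdvd #|A| (\sum_(a in A) mark (D :|: [set a]) v)%R.
Proof.
move=> sA sD nDA; elim/burnside_loc_ind: v => [a u v Du Dv | T X].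
  rewrite (eq_bigr _ (fun E _ => mark_linear _ a u v)) big_split /= -mulr_sumr.
  by apply: ZdvdD Dv; apply: ZdvdMl.
rewrite (eq_bigr (fun a => #|'Fix_(bfix X D | biset_action X)[a]|%:R)%R); last first.
  move=> a _; rewrite mark_of; congr (_%:R)%R; apply: eq_card => x.
  by rewrite /bfix afixU.
rewrite -natr_sum (Frobenius_Cauchy (acts_bfix X sA sD nDA)).
by apply: Zdvd_of_nat; apply: dvdn_mull.
Qed.

End OrbitCounting.

(** * Stability in terms of marks *)

Section Stability.
Local Open Scope group_scope.
Variables (gT : finGroupType) (S : {group gT}) (F : fusion_system S) (p : nat).
Implicit Types P Q R : {group gT}.

Lemma diag_fgraph P : P \subset S -> fgraph F P (diag P).
Proof. by move=> sPS; apply/fgraph_fhom/(fhom_toS (fhom_id F sPS)). Qed.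

(** For k = 0 this is two-sided stability in terms of marks; the truncation to
    subgroups of order at least k is the invariant of the downward induction which constructs a
    characteristic element. *)
Definition class_marks_ge k (v : burnside_loc S S p) : Prop :=
  forall Q R D E, fgraph F Q D -> fgraph F R E -> fconj F Q R -> (k <= #|Q|)%N ->
    mark D v = mark E v.

Definition class_marks := class_marks_ge 0.

(** Evaluating left stability for phi at the diagonal of Q compares
    Delta(Q, phi) with Delta(Q, id); evaluating right stability at Delta(Q, phi) compares the
    diagonal of phi(Q) with Delta(Q, phi). *)
Lemma stable_class_marks (v : burnside_loc S S p) :
  left_stable F v -> right_stable F v -> class_marks v.
Proof.
move=> lst rst.
have leftE Q D : fgraph F Q D -> mark D v = mark (diag Q) v.
  case=> phi Fphi ->; have sQS := fhom_subl Fphi.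
  have sd : diag Q \subset setX Q S by apply: graph_sub; rewrite // morphim_idm.
  have /(congr1 (mark (diag Q))) := lst Q phi Fphi.
  rewrite (mark_tr_comp (phi := phi)) ?(fhom_imS Fphi) //; last 2 first.
  - by move=> u Qu; apply: invmE.
  - by move=> u Qu; apply: invmK.
  rewrite (mark_tr_comp (phi := idm_morphism Q)) ?morphim_idm // -!imset_comp => E.
  have -> : graph phi = [set (fun u => (phi u, u)) u | u in Q] by [].
  exact: E.
have rightE Q R : fconj F Q R -> mark (diag R) v = mark (diag Q) v.
  case/fconjP=> phi Fphi imphi.
  have {}Fphi := fhom_toS Fphi; have sQS := fhom_subl Fphi.
  have sd : graph phi \subset setX S Q by apply: graph_sub; rewrite ?(fhom_imS Fphi).
  have /(congr1 (mark (graph phi))) := rst Q phi Fphi.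
  rewrite !mark_comp_tr ?(fhom_imS Fphi) ?morphim_idm // -!imset_comp.
  rewrite -(leftE Q (graph phi)) => [E|]; last exact: fgraph_fhom.
  transitivity (mark (graph phi) v); last by [].
  rewrite -[RHS]E; congr (mark _ v).
  by rewrite /graph -imphi morphimEdom -imset_comp.
by move=> Q R D E /leftE-> /leftE-> /rightE ->.
Qed.

Section MapMarks.
Variables (v : burnside_loc S S p).
Variable k : nat.
Hypotheses (Fv : fgenerated F v) (clv : class_marks_ge k v).

(** If one of the two subgroups is a graph of F then so is the other, over a conjugate
    domain; if neither is, both marks vanish because v is F-generated. *)
Lemma mark_map (A B : {group gT}) (alpha : {morphism A >-> gT})
    (beta : {morphism B >-> gT}) (L : {group gT * gT}) :
    L \subset setX B A -> fhom F S alpha -> fhom F S beta -> (k <= #|L|)%N ->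
  mark [set (beta d.1, alpha d.2) | d in L] v = mark L v.
Proof.
move=> sL Falpha Fbeta kL; set L' := imset _ _.
have gL' : group_set L'.
  apply/group_setP; split=> [|_ _ /imsetP[[h u] Lh ->] /imsetP[[l w] Ll ->]].
    by apply/imsetP; exists 1; rewrite ?group1 //= !morph1.
  have /setXP[Bh Au] := subsetP sL _ Lh; have /setXP[Bl Aw] := subsetP sL _ Ll.
  by apply/imsetP; exists (h * l, u * w); [apply: (groupM Lh Ll) | rewrite /= !morphM].
have [sAS sBS] := (fhom_subl Falpha, fhom_subl Fbeta).
have sLS : L \subset setX S S by apply: subset_trans sL _; apply: setXS.
have sL'i : L' \subset setX (beta @* B) (alpha @* A).
  apply/subsetP=> _ /imsetP[[h u] /(subsetP sL)/setXP[Bh Au] ->].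
  by rewrite inE /= !mem_morphim.
have sL'S : L' \subset setX S S.
  by apply: subset_trans sL'i _; apply: setXS; [apply: fhom_imS Fbeta | apply: fhom_imS Falpha].
have [z | nz] := eqVneq (mark L v) 0%R; last first.
  have [Q gQ] := mark_fgenerated Fv sLS nz.
  have [R QR gR] := fgraph_map gQ sL Falpha Fbeta.
  by apply/esym/(clv gQ gR QR); rewrite -(fgraph_card gQ).
rewrite z; apply/eqP; apply/negPn/negP => nz.
have [Q gQ] := mark_fgenerated (D := Group gL') Fv sL'S nz.
have [a [Fa Ka _ _]] := fhom_inverse Falpha.
have [b [Fb Kb _ _]] := fhom_inverse Fbeta.
have [R QR] := fgraph_map gQ sL'i (fhom_toS Fa) (fhom_toS Fb).
have -> : [set (b d.1, a d.2) | d in Group gL'] = L :> {set _}.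
  rewrite /= -imset_comp -[RHS]imset_id; apply: eq_in_imset => -[h u] /(subsetP sL)/setXP[Bh Au] /=.
  by rewrite Ka // Kb.
move=> gR; case/eqP: nz; rewrite /= (clv gQ gR QR) //.
by rewrite (fconj_card QR) -(fgraph_card gR).
Qed.

End MapMarks.

Section Converse.
Variable v : burnside_loc S S p.
Hypotheses (Fv : fgenerated F v) (clv : class_marks v).

Lemma class_marks_right : right_stable F v.
Proof.
move=> P phi Fphi; have sPS := fhom_subl Fphi; apply: marks_inj => L sL.
have Fi := fhom_toS (fhom_id F (subxx S)).
rewrite !mark_comp_tr ?(fhom_imS Fphi) ?morphim_idm //=.
rewrite (mark_map Fv clv (alpha := phi) (beta := idm_morphism S) sL Fphi Fi) //.
by congr (mark _ v); rewrite -[LHS]imset_id; apply: eq_imset => -[].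
Qed.

Lemma class_marks_left : left_stable F v.
Proof.
move=> P phi Fphi; have sPS := fhom_subl Fphi; apply: marks_inj => L sL.
have Fi := fhom_toS (fhom_id F (subxx S)).
rewrite (mark_tr_comp (phi := phi)) ?(fhom_imS Fphi) //; last 2 first.
- by move=> u Qu; apply: invmE.
- by move=> u Qu; apply: invmK.
rewrite (mark_tr_comp (phi := idm_morphism P)) ?morphim_idm //.
rewrite (mark_map Fv clv (alpha := idm_morphism S) (beta := phi) sL Fi Fphi) //.
by congr (mark _ v); rewrite -[LHS]imset_id; apply: eq_imset => -[].
Qed.

End Converse.
End Stability.

(** * Counting the graphs over a subgroup *)

Section Counting.
Local Open Scope group_scope.
Variables (gT : finGroupType) (S : {group gT}) (F : fusion_system S).
Implicit Types P Q R : {group gT}.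

Definition fgraphs P : {set {set gT * gT}} := [set D | `[< fgraph F P D >]].
Definition fclass P : {set {group gT}} := [set Q | `[< fconj F P Q >]].

Lemma fgraphsP P D : reflect (fgraph F P D) (D \in fgraphs P).
Proof. by rewrite inE; apply: asboolP. Qed.

Lemma fclassP P Q : reflect (fconj F P Q) (Q \in fclass P).
Proof. by rewrite inE; apply: asboolP. Qed.

Lemma AutFP P a : P \subset S ->
  reflect (a \in Aut P /\ exists2 phi : {morphism P >-> gT}, fhom F P phi & {in P, phi =1 a})
    (a \in AutF F P).
Proof.
move=> sPS; apply: (iffP setIdP) => -[Aa].
  by move=> /asboolP[phi [Fphi E]]; split=> //; exists phi.
by move=> [phi Fphi E]; split=> //; apply/asboolP; exists phi.
Qed.

(** The morphisms on P with image Q are theta o a for a fixed isomorphism theta from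
    P to Q and a in Aut_F(P). *)
Lemma card_fgraphs P : P \subset S -> #|fgraphs P| = (#|fclass P| * #|AutF F P|)%N.
Proof.
move=> sPS; rewrite -sum1_card.
pose im1 (D : {set gT * gT}) : {set gT} := fst @: D.
rewrite (partition_big (fun D => <<im1 D>>%G) (mem (fclass P))) /=; last first.
  move=> D /fgraphsP[phi Fphi ->]; apply/fclassP.
  have -> : <<im1 (graph phi)>>%G = (phi @* P)%G.
    by apply/val_inj; rewrite /= /im1 graph_fst genGid.
  exact: fconj_im Fphi.
rewrite -sum_nat_const; apply: eq_bigr => Q /fclassP/fconjP[theta Ftheta imt].
have thetaI : {in P &, injective theta} := injmP (fhom_injm Ftheta).
pose gr (a : {perm gT}) := [set (theta (a u), u) | u in P].
have AutI a u : a \in Aut P -> u \in P -> a u \in P.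
  by move=> Aa Pu; rewrite Aut_closed.
rewrite sum1dep_card -(card_in_imset (f := gr) (D := AutF F P)); last first.
  move=> a b /(AutFP _ sPS)[Aa _] /(AutFP _ sPS)[Ab _] E.
  apply: (eq_Aut Aa Ab) => u Pu; apply: thetaI; rewrite ?AutI //.
  have : (theta (a u), u) \in gr b by rewrite -E; apply/imsetP; exists u.
  by case/imsetP=> w _ [-> <-].
apply: eq_card => D; rewrite [LHS]inE; apply/andP/imsetP => [[/fgraphsP[phi Fphi ->] /eqP EQ] | [a]].
  have imphi : phi @* P = Q by rewrite -EQ /= /im1 graph_fst genGid.
  have [psi [Fpsi K1 K2 imp]] := fhom_inverse Ftheta.
  have Fphi' : fhom F (theta @* P)%G phi.
    by apply: fhom_widen Fphi _ (fhom_imS Ftheta); rewrite imphi /= imt.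
  have [chi Fchi Echi] := fhom_compose Fphi' Fpsi.
  have inj := fhom_injm Fchi.
  have im : chi @* P = P.
    by apply/eqP; rewrite eqEcard (fhom_im Fchi) card_injm ?leqnn.
  exists (aut inj im); first by apply/AutFP=> //; split; [apply: Aut_aut | exists chi => // u Pu; rewrite autE].
  apply: eq_in_imset => u Pu; rewrite autE // Echi //= K2 //= imt -imphi.
  by rewrite mem_morphim.
case/(AutFP _ sPS)=> Aa [chi Fchi Echi ->].
have [phi Fphi Ephi] := fhom_compose Fchi (fhom_toS Ftheta).
have -> : gr a = graph phi.
  by apply: eq_in_imset => u Pu; rewrite Ephi //= Echi.
split; first by apply/fgraphsP/fgraph_fhom.
apply/eqP/val_inj; rewrite /= /im1 graph_fst genGid -imt.
have imchi : chi @: P = P.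
  rewrite -morphimEdom; apply/eqP; rewrite eqEcard (fhom_im Fchi).
  by rewrite card_injm ?(fhom_injm Fchi) /=.
rewrite (morphimEdom theta) /= (morphimEdom phi); apply/setP=> z; apply/imsetP/imsetP => -[u].
  move=> Pu ->; exists (chi u); last by rewrite Ephi.
  by rewrite (subsetP (fhom_im Fchi)) // mem_morphim.
move=> Pu ->; have : u \in chi @: P by rewrite imchi.
by case/imsetP=> w Pw ->; exists w; rewrite ?Ephi.
Qed.

(** S acts on the F-conjugates of P, and the orbit of Q has #|S : 'N_S(Q)|
    elements. *)
Lemma card_fclass_dvd P n :
    (forall Q, fconj F P Q -> (#|'N_S(Q)| %| n)%N) ->
  (#|S| %| #|fclass P| * n)%N.
Proof.
move=> Nn; have actS : [acts S, on fclass P | 'JG].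
  apply/actsP=> s Ss Q; apply/fclassP/fclassP => PQ; last first.
    by apply: (fconj_trans PQ); apply: fconj_conjg => //; case: (fconj_sub PQ).
  apply: (fconj_trans PQ); apply: fconj_sym; apply: fconj_conjg => //.
  by rewrite -(conjSg _ _ s) (conjGid Ss); case: (fconj_sub PQ).
rewrite -(acts_sum_card_orbit actS) big_distrl /=; apply: dvdn_sum => _ /imsetP[Q PQ ->].
rewrite -(card_orbit_in_stab 'JG Q (subsetT S)) dvdn_pmul2l; last first.
  by apply/card_gt0P; exists Q; apply: orbit_refl.
by rewrite astab1JG; apply/Nn/fclassP.
Qed.

(** S acts on the morphisms from P to S by conjugating their values, and the
    stabilizer of phi is the centralizer of phi(P). *)
Lemma card_fgraphs_dvd P n :
    (forall Q, fconj F P Q -> (#|'C_S(Q)| %| n)%N) ->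
  (#|S| %| #|fgraphs P| * n)%N.
Proof.
move=> Cn; pose S1 := setX_group S (1 : {group gT}).
have cardS1 : #|S1| = #|S| by rewrite cardsX cards1 muln1.
have actS : [acts S1, on fgraphs P | 'Js].
  have half s D : s \in S1 -> fgraph F P D -> fgraph F P (D :^ s).
    case: s => s t /setXP[Ss /set1P->] [phi Fphi ->].
    have [c Fc Ec] := fhom_conjg F (subxx S) Ss.
    have [chi Fchi Echi] := fhom_compose Fphi Fc.
    exists chi => //; rewrite /graph /conjugate -imset_comp; apply: eq_in_imset => u Pu /=.
    rewrite Echi //= Ec; last by rewrite (subsetP (fhom_imS Fphi)) ?mem_morphim.
    by congr pair; rewrite /= invg1 mul1g mulg1.
  apply/actsP=> s Ss D; apply/fgraphsP/fgraphsP; last exact: half.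
  move=> /(half s^-1); rewrite groupV conjsgK; exact.
rewrite -cardS1 -(acts_sum_card_orbit actS) big_distrl /=.
apply: dvdn_sum => _ /imsetP[D gD ->].
rewrite -(card_orbit_in_stab 'Js D (subsetT S1)) dvdn_pmul2l; last first.
  by apply/card_gt0P; exists D; apply: orbit_refl.
move: gD => /fgraphsP[phi Fphi ->].
suff -> : 'C_S1[graph phi | 'Js] = setX 'C_S(phi @* P) 1.
  rewrite cardsX cards1 muln1; apply: (Cn (phi @* P)%G); exact: fconj_im Fphi.
apply/setP=> -[s t]; rewrite astab1Js; apply/setIP/setXP.
  move=> [/setXP[Ss /set1P->] /normP nD]; split; last exact: set11.
  apply/setIP; split=> //; apply/centP=> _ /morphimP[u _ Pu ->].
  have : (phi u, u) ^ (s, 1) \in graph phi.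
    by rewrite -nD memJ_conjg; apply/graphP.
  case/graphP=> /= _; rewrite invg1 mul1g mulg1 => E.
  by rewrite /commute -{1}E mulKVg.
move=> [/setIP[Ss /centP cs] /set1P->]; split; first by rewrite inE /= Ss set11.
apply/normP; rewrite /conjugate -[RHS]imset_id; apply: eq_in_imset => -[h u] /graphP[Pu ->].
congr pair; rewrite /= ?invg1 ?mul1g ?mulg1 //.
by rewrite -(cs (phi u)) ?mem_morphim // mulKg.
Qed.
End Counting.

(** * Characteristic elements force saturation *)

Local Open Scope group_scope.
Lemma card_AutS (gT : finGroupType) (S P : {group gT}) :
  (#|'N_S(P)| = #|AutS S P| * #|'C_S(P)|)%N.
Proof.
rewrite /AutS card_morphim ker_conj_aut.
have -> : 'N(P) :&: 'N_S(P) = 'N_S(P) by apply/setIidPr/subsetIr.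
rewrite -[#|'C_S(P)|]/#|S :&: 'C(P)|.
have -> : S :&: 'C(P) = 'N_S(P) :&: 'C(P).
  by rewrite -setIA (setIidPr (cent_sub P)).
by rewrite mulnC LagrangeI.
Qed.

Section NormGraph.
Local Open Scope group_scope.
Variables (gT : finGroupType) (S P : {group gT}) (phi : {morphism P >-> gT}).

Local Notation A := 'N_(setX S S)(graph phi).

(** (y, x) normalizes Delta(P, phi) exactly when x lies in N_phi and y is a witness for
    this. *)
Lemma norm_graphP y x : reflect [/\ y \in S, x \in S & {in P, forall u,
    u ^ x \in P /\ phi (u ^ x) = phi u ^ y}] ((y, x) \in A).
Proof.
apply: (iffP setIP) => [[/setXP[Sy Sx] /normP nD] | [Sy Sx Exy]].
  split=> // u Pu; have : (phi u, u) ^ (y, x) \in graph phi.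
    by rewrite -nD memJ_conjg; apply/graphP.
  by case/graphP=> Pux <-.
split; first by rewrite inE /= Sy Sx.
apply/normP/eqP; rewrite eqEcard cardJg leqnn andbT.
apply/subsetP=> _ /imsetP[_ /imsetP[u Pu ->] ->]; apply/graphP.
by have [Pux Ex] := Exy u Pu; split; last exact/esym.
Qed.

(** The second projection maps the normalizer of Delta(P, phi) onto N_phi, with
    kernel the centralizer of phi(P). *)
Lemma card_norm_graph : P \subset S -> phi @* P \subset S ->
  [/\ #|A :&: setX S 1| = #|'C_S(phi @* P)|, snd @: A = extender S phi
    & #|A| = (#|extender S phi| * #|'C_S(phi @* P)|)%N].
Proof.
move=> sPS sphiS; have AP := norm_graphP.
have AC : A :&: setX S 1 = setX 'C_S(phi @* P) [1 gT].
  apply/setP=> -[s t]; apply/setIP/setXP => [[/AP[Ss _ Es] /setXP[_ t1]] | [/setIP[Ss /centP cs] t1]].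
    split=> //; rewrite inE Ss; apply/centP=> _ /morphimP[u _ Pu ->].
    have [_] := Es u Pu; rewrite (set1P t1) conjg1 => E.
    by rewrite /commute [in LHS]E conjgE mulKVg.
  rewrite (set1P t1); split; last by rewrite inE /= Ss set11.
  apply/AP; split=> // u Pu; rewrite conjg1; split=> //.
  by rewrite conjgE -(cs (phi u)) ?mulKg // mem_morphim.
have cAC : #|A :&: setX S 1| = #|'C_S(phi @* P)|.
  by rewrite AC cardsX cards1 muln1.
have extE : snd @: A = extender S phi.
  apply/setP=> x; apply/imsetP/setIdP => [[[y x'] Ayx /= ->] | [Nx /exists_inP[y Ny /forall_inP Exy]]].
    have /AP[Sy Sx Eyx] := Ayx; have /AP[_ _ Einv] : (y^-1, x'^-1) \in A by rewrite (groupVr Ayx).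
    split.
      apply/setIP; split=> //; rewrite inE; apply/subsetP=> _ /imsetP[u Pu ->].
      by case: (Eyx u Pu).
    apply/exists_inP; exists y.
      apply/setIP; split=> //; rewrite inE; apply/subsetP=> _ /imsetP[_ /morphimP[u _ Pu ->] ->].
      by case: (Eyx u Pu) => Pux <-; rewrite mem_morphim.
    apply/forall_inP=> u Pu; have [_] := Einv u Pu.
    by rewrite !conjgE !invgK !mulgA => ->.
  have [[Sx nx] [Sy _]] := (setIP Nx, setIP Ny).
  exists (y, x) => //; rewrite -[(y, x)]invgK groupV; apply/AP.
  rewrite !groupV; split=> // u Pu; split; first by rewrite memJ_norm ?groupV.
  by rewrite !conjgE !invgK !mulgA; apply/eqP/Exy.
have cA : #|A| = (#|extender S phi| * #|'C_S(phi @* P)|)%N.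
  rewrite -extE -cAC -(LagrangeI A (setX_group S [1 gT])) mulnC; congr (_ * _)%N.
  have -> : snd @: A = snd_morphism gT gT @* A by rewrite morphimE setTI.
  rewrite card_morphim setTI -indexgI -[RHS]indexgI; congr #|A : _|.
  apply/setP=> -[y x]; rewrite !in_setI; apply: andb_id2l.
  case/andP=> /setXP[Sy _] _.
  by rewrite in_setX Sy in_setT [in RHS]inE.
by [].
Qed.

End NormGraph.

Section CharacteristicSaturated.
Local Open Scope group_scope.
Variables (gT : finGroupType) (S : {group gT}) (F : fusion_system S) (p : nat).
Hypotheses (p_pr : prime p) (pS : p.-group S).
Implicit Types P Q R : {group gT}.

Lemma pgroup_setX : p.-group (setX S S).
Proof. by rewrite /pgroup cardsX pnatM -!/(pgroup _ _) pS. Qed.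

(** The congruence [mark_sum_stab] for A = S x P and D = 1. The subgroups E
    which occur have order #|P|, and those with a nonzero mark are graphs of F over P; their marks
    are all equal. *)
Lemma augmentation_class (v : burnside_loc S S p) P :
    fgenerated F v -> class_marks F v -> P \subset S ->
  Zdvd (p * #|S|) (#|S|%:R * augmentation v - #|fgraphs F P|%:R * mark (diag P) v)%R.
Proof.
move=> Fv clv sPS; have sA : setX S P \subset setX S S by rewrite setXS.
have pA : p.-group (setX_group S P) by apply: pgroupS sA pgroup_setX.
have := mark_sum_stab v p_pr pA sA (sub1G _) (norms1 _).
have -> : setX S P :&: setX S 1 = setX S 1.
  by apply/setIidPr; rewrite setXS ?sub1G.
rewrite [#|setX S 1|]cardsX cards1 muln1 augmentation_card.
congr (Zdvd _ (_ - _))%R.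
rewrite (bigID (mem (fgraphs F P))) /= [X in (_ + X)%R]big1 ?addr0; last first.
  move=> E /andP[/and4P[gE _ sE cE] nE]; apply/eqP; apply: contraR nE => nz.
  have sES := subset_trans sE sA.
  have [Q gQ] := mark_fgenerated (D := Group gE) Fv sES nz.
  have eqQP : Q = P.
    apply/val_inj/eqP; rewrite /= eqEcard; apply/andP; split.
      case: gQ => phi _ /= EE; apply/subsetP=> u Qu.
      have : (phi u, u) \in E by rewrite EE; apply/graphP.
      by move/(subsetP sE)/setXP=> [].
    move: cE; rewrite -(fgraph_card gQ) /= cardsX mulnC.
    by rewrite eqn_pmul2l ?cardG_gt0 // => /eqP->.
  by apply/fgraphsP; rewrite -eqQP.
rewrite (eq_bigr (fun=> mark (diag P) v)); last first.
  move=> E /andP[_ /fgraphsP gE].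
  exact: (clv _ _ _ _ gE (diag_fgraph F sPS) (fconj_refl F sPS) (leq0n _)).
rewrite (eq_bigl (mem (fgraphs F P))) ?sumr_const ?mulr_natl // => E /=.
apply: andb_idl => /fgraphsP[phi Fphi ->].
rewrite groupP sub1G graph_sub ?(fhom_imS Fphi) //=.
by rewrite card_graph cardsX mulnC.
Qed.

Variable v : burnside_loc S S p.
Hypotheses (Fv : fgenerated F v) (clv : class_marks F v).
Hypothesis (v_unit : ~ Zdvd p (augmentation v)).

Lemma pnat_leq_dvd a b : p.-nat a -> p.-nat b -> (a <= b)%N -> (a %| b)%N.
Proof.
by move=> /p_natP[m ->] /p_natP[n ->]; rewrite leq_exp2l ?prime_gt1 // => /dvdn_exp2l.
Qed.

Lemma fully_centralized_dvd P Q : fully_centralized F P -> fconj F Q P ->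
  (#|'C_S(Q)| %| #|'C_S(P)|)%N.
Proof.
move=> fcP QP; apply: pnat_leq_dvd; try exact: (pgroupS (subsetIl _ _) pS).
exact/fcP/fconj_sym.
Qed.

(** Put c = #|'C_S(P0)| and let f be the mark at the diagonal of P. The left
    action of 'C_S(P0) is free, so c divides f; and #|S| divides c times the number of morphisms
    from P to S. By [augmentation_class] the product of the quotients f / c and
    c #|fgraphs F P| / #|S| is congruent to the augmentation modulo p, so both are prime to p. *)
Lemma class_mark_valuation P P0 : fconj F P P0 -> fully_centralized F P0 ->
  exists g m, [/\ mark (diag P) v = #|'C_S(P0)|%:R * g,
     ~ Zdvd p g, (#|fgraphs F P| * #|'C_S(P0)| = #|S| * m)%N & ~~ (p %| m)%N]%R.
Proof.
move=> PP0 fc0; have [sPS sP0S] := fconj_sub PP0.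
have [psi Fpsi impsi] := fconjP PP0.
have gpsi := fgraph_fhom (fhom_toS Fpsi).
have [g Eg] : Zdvd #|'C_S(P0)| (mark (diag P) v).
  rewrite (clv (diag_fgraph F sPS) gpsi (fconj_refl F sPS) (leq0n _)).
  have -> : #|'C_S(P0)| = #|setX 'C_S(P0) [1 gT]| by rewrite cardsX cards1 muln1.
  apply: mark_left_dvd (setXS (subsetIl _ _) (subxx _)) (fgraph_sub gpsi) _.
  apply/subsetP=> -[s t] /setXP[/setIP[Ss /centP cs] /set1P->]; apply/normP.
  rewrite /conjugate -[RHS]imset_id; apply: eq_in_imset => -[h u] /graphP[Pu ->].
  congr pair; rewrite /= ?invg1 ?mul1g ?mulg1 //.
  by rewrite -(cs (psi u)) ?mulKg // -impsi mem_morphim.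
have [m Em] : exists m, (#|fgraphs F P| * #|'C_S(P0)| = #|S| * m)%N.
  have /dvdnP[m ->] : (#|S| %| #|fgraphs F P| * #|'C_S(P0)|)%N.
    apply: card_fgraphs_dvd => Q PQ; apply: fully_centralized_dvd => //.
    by apply: fconj_trans PP0; apply: fconj_sym.
  by exists m; rewrite mulnC.
have [y Ey] := augmentation_class Fv clv sPS.
(* Divide the congruence by #|S|, using Em. *)
have Eaug : (augmentation v = m%:R * g + p%:R * y)%R.
  apply: (Zlocal_mulnI (cardG_gt0 S)); rewrite mulrDr mulrA -natrM -Em.
  rewrite natrM -mulrA -Eg mulrA -natrM [(#|S| * p)%N]mulnC -Ey.
  by rewrite addrC subrK.
exists g, m; split=> //.
  by move=> [z Ez]; apply: v_unit; exists (m%:R * z + y)%R; rewrite Eaug Ez mulrDr mulrCA.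
apply/negP=> /dvdnP[k Ek]; apply: v_unit; exists (k%:R * g + y)%R.
by rewrite Eaug Ek mulrDr mulnC natrM mulrA.
Qed.

Lemma ex_fully_centralized P : P \subset S ->
  exists2 P0, fconj F P P0 & fully_centralized F P0.
Proof.
move=> sPS; have rP : `[< fconj F P P >] by apply/asboolP/fconj_refl.
case: (@arg_maxnP _ P (fun Q => `[< fconj F P Q >]) (fun Q : {group gT} => #|'C_S(Q)|) rP) => P0 /asboolP PP0 max0.
exists P0 => // Q P0Q; apply: max0; apply/asboolP; exact: fconj_trans P0Q.
Qed.

(** The first saturation axiom, by arithmetic alone. With n = #|'N_S(P)|,
    n = #|AutS S P| #|'C_S(P)|, #|fclass F P| n = #|S| k,
    #|AutF F P| = #|AutS S P| t and #|'C_S(P0)| = e #|'C_S(P)|, the number m prime to p of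
    [class_mark_valuation] is t k e. Hence t is prime to p, and the power e of p is 1. *)
Lemma characteristic_Sylow P : P \subset S -> fully_normalized F P ->
  fully_centralized F P /\ p.-Sylow(AutF F P) (AutS S P).
Proof.
move=> sPS fnP; have [P0 PP0 fc0] := ex_fully_centralized sPS.
have [g [m [_ _ Em pm]]] := class_mark_valuation PP0 fc0.
have /dvdnP[e Ee] := fully_centralized_dvd fc0 PP0.
have [k Ek] : exists k, (#|fclass F P| * #|'N_S(P)| = #|S| * k)%N.
  have /dvdnP[k ->] : (#|S| %| #|fclass F P| * #|'N_S(P)|)%N.
    apply: card_fclass_dvd => Q PQ.
    by apply: pnat_leq_dvd; try exact: (pgroupS (subsetIl _ _) pS); apply: fnP.
  by exists k; rewrite mulnC.
have sAut : AutS S P \subset AutF F P.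
  apply/subsetP=> _ /morphimP[x nPx Nx ->]; have [Sx nx] := setIP Nx.
  apply/(AutFP _ _ sPS); split; first exact: Aut_aut.
  have [phi Fphi Ephi] := fhom_conjg F sPS Sx.
  exists phi; last by move=> u Pu; rewrite Ephi // norm_conj_autE.
  apply: fhom_widen Fphi _ sPS; apply/subsetP=> _ /morphimP[u _ Pu ->].
  by rewrite Ephi // memJ_norm.
have gAutS : group_set (AutS S P) by rewrite /AutS groupP.
have [t Et] : exists t, (#|AutF F P| = #|AutS S P| * t)%N.
  have /dvdnP[t ->] : (#|AutS S P| %| #|AutF F P|)%N.
    exact: (@cardSg _ (Group (AutF_group_set F sPS)) (Group gAutS)).
  by exists t; rewrite mulnC.
have EN := card_AutS S P.
have c0 := cardG_gt0 'C_S(P)%G; have S0 := cardG_gt0 S.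
have s0 : (0 < #|AutS S P|)%N by apply: (cardG_gt0 (Group gAutS)).
have Etm : (t * k * e = m)%N.
  have Ef := card_fgraphs F sPS.
  apply/eqP; rewrite -(eqn_pmul2l S0) -(eqn_pmul2l c0) -(eqn_pmul2l s0); apply/eqP.
  transitivity (#|S| * k * (#|AutS S P| * t) * (e * #|'C_S(P)|))%N; first by ring.
  rewrite -Ek -Et -Ee.
  transitivity (#|fclass F P| * #|AutF F P| * #|'C_S(P0)| * #|'N_S(P)|)%N; first by ring.
  by rewrite -Ef Em EN; ring.
have e1 : e = 1%N.
  have /p_natP[n En] : p.-nat e.
    apply: pnat_dvd (pgroupS (subsetIl S 'C(P0)) pS : p.-nat _).
    by rewrite Ee dvdn_mulr.
  case: n En => // n En; case/negP: pm; rewrite -Etm En expnS.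
  by rewrite mulnCA dvdn_mulr.
have EC : #|'C_S(P0)| = #|'C_S(P)| by rewrite Ee e1 mul1n.
split.
  move=> Q PQ; rewrite -EC; apply: fc0; apply: fconj_trans PQ; exact: fconj_sym.
apply/and3P; split=> //; first exact: morphim_pgroup (pgroupS (subsetIl _ _) pS).
rewrite -(@divgS _ (Group (AutF_group_set F sPS)) (Group gAutS)) //=.
rewrite Et mulKn // p'natE //; apply: contra pm => pt.
by rewrite -Etm -mulnA dvdn_mulr.
Qed.

(** The second saturation axiom. Let A be the normalizer of Delta(P, phi).
    By [class_mark_valuation] the mark at Delta(P, phi) is #|C| times an element prime to p, for C
    the centralizer of phi(P). So the congruence [mark_sum_stab] has a nonzero term: a graph D of
    F between Delta(P, phi) and A with #|D| #|C| = #|A|. As A maps onto N_phi with kernel of order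
    #|C|, this is the graph of a morphism on N_phi, which extends phi. *)
Lemma characteristic_extension P (phi : {morphism P >-> gT}) :
    fhom F S phi -> fully_centralized F (phi @* P)%G ->
  exists psi : {morphism extender_group S phi >-> gT},
    fhom F S psi /\ {in P, psi =1 phi}.
Proof.
move=> Fphi fc; have sPS := fhom_subl Fphi.
have sphiS := fhom_imS Fphi.
have PphiP := fconj_im Fphi.
have [g [m [Eg pg _ _]]] := class_mark_valuation PphiP fc.
have gphi := fgraph_fhom Fphi.
pose A := ('N_(setX S S)(graph phi))%G.
have sA : A \subset setX S S by apply: subsetIl.
have sDA : graph phi \subset A by rewrite subsetI (fgraph_sub gphi) normG.
have nDA : A \subset 'N(graph phi) by apply: subsetIr.
have pA : p.-group A by apply: pgroupS sA pgroup_setX.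
have [cAC extE cA] := card_norm_graph sPS sphiS.
have [D /and5P[gD sD sDA' cD nz]] : exists D : {set gT * gT},
    [&& group_set D, graph phi \subset D, D \subset A,
        (#|D| * #|'C_S(phi @* P)| == #|A|)%N & mark D v != 0%R].
  apply/existsP; apply: contra_notT pg; rewrite negb_exists => /forallP z.
  have /= := mark_sum_stab v p_pr pA sA sDA nDA; rewrite big1; last first.
    move=> D /and4P[h1 h2 h3 h4]; apply/eqP; move: (z D).
    by rewrite h1 h2 h3 -cAC h4 /= negbK.
  rewrite subr0 cAC (clv gphi (diag_fgraph F sPS) (fconj_refl F sPS) (leq0n _)) Eg.
  move=> [y Ey]; exists y; apply: (@Zlocal_mulnI p _ _ _ (cardG_gt0 'C_S(phi @* P)%G)).
  by rewrite Ey natrM mulrCA mulrA.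
have [R gR] := mark_fgenerated (D := Group gD) Fv (subset_trans sDA' sA) nz.
have cR : #|R| = #|extender S phi|.
  apply/eqP; rewrite -(eqn_pmul2r (cardG_gt0 'C_S(phi @* P)%G)) /= -cA -(eqP cD).
  by rewrite -(fgraph_card gR).
have ER : R = extender_group S phi.
  apply/val_inj/eqP; rewrite /= eqEcard cR leqnn andbT -extE.
  case: gR => chi _ /= ED; rewrite -(graph_snd chi) -ED; exact: imsetS.
move: gR; rewrite ER => -[psi Fpsi /= ED]; exists psi; split=> // u Pu.
have : (phi u, u) \in D by rewrite (subsetP sD) //; apply/graphP.
by rewrite ED => /graphP[].
Qed.

End CharacteristicSaturated.

(** * Transporting normalizers of graphs in a saturated fusion system *)

Section PairMorphism.
Variables (gT : finGroupType) (A B : {group gT}).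
Variables (alpha : {morphism A >-> gT}) (beta : {morphism B >-> gT}).

Definition pairm (d : gT * gT) : gT * gT := (beta d.1, alpha d.2).

Fact pairmM : {in setX B A &, {morph pairm : c d / c * d}}.
Proof. by move=> [h u] [l w] /setXP[Bh Au] /setXP[Bl Aw]; rewrite /pairm /= !morphM. Qed.

Canonical pairm_morphism := Morphism pairmM.

Lemma injm_pairm : 'injm alpha -> 'injm beta -> 'injm pairm.
Proof.
move=> /injmP injA /injmP injB; apply/injmP=> -[h u] [l w] /setXP[Bh Au] /setXP[Bl Aw].
by case=> /injB-> // /injA->.
Qed.

End PairMorphism.

Section SaturatedCharacteristic.
Variables (gT : finGroupType) (S : {group gT}) (F : fusion_system S) (p : nat).
Hypotheses (p_pr : prime p) (pS : p.-group S) (satF : saturated F p).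
Implicit Types P Q R : {group gT}.

Lemma ex_fully_normalized Q : Q \subset S ->
  exists2 P, fconj F Q P & fully_normalized F P.
Proof.
move=> sQS; have rQ : `[< fconj F Q Q >] by apply/asboolP/fconj_refl.
case: (@arg_maxnP _ Q (fun R => `[< fconj F Q R >]) (fun R : {group gT} => #|'N_S(R)|) rQ).
move=> P /asboolP QP maxP.
exists P => // R PR; apply: maxP; apply/asboolP; exact: fconj_trans PR.
Qed.

(** Compose an isomorphism phi from Q to P with an automorphism chi of P which
    conjugates the p-subgroup phi Aut_S(Q) phi^-1 of Aut_F(P) into the Sylow subgroup Aut_S(P).
    Then N_(chi phi) is all of 'N_S(Q), and the second axiom applies since P is fully
    centralized. *)
Lemma extend_normalizer P Q : fully_normalized F P -> fconj F Q P ->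
  exists2 alpha : {morphism 'N_S(Q) >-> gT}, fhom F S alpha & alpha @: Q = P.
Proof.
move=> fnP QP; have [sQS sPS] := fconj_sub QP.
have [fcP sylP] := satF.1 P sPS fnP.
case/fconjP: QP => phi Fphi imphi; have {imphi}EP : P = (phi @* Q)%G by apply: val_inj.
subst P; have inj := fhom_injm Fphi.
(* B is phi Aut_S(Q) phi^-1. *)
pose B := Aut_isom inj (subxx Q) @* AutS S Q.
have pB : p.-group B.
  by do 2!apply: morphim_pgroup; apply: pgroupS pS; apply: subsetIl.
have BP b : reflect (exists2 n, n \in 'N_S(Q) & b = Aut_isom inj (subxx Q) (conj_aut Q n)) (b \in B).
  apply: (iffP morphimP) => [[_ _ /morphimP[n _ Nn ->] ->] | [n Nn ->]]; first by exists n.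
  exists (conj_aut Q n) => //; first exact: Aut_aut.
  by rewrite mem_morphim //; case/setIP: Nn.
have sB : B \subset AutF F (phi @* Q)%G.
  have [phi' [Fphi' K1 K2 _]] := fhom_inverse Fphi.
  apply/subsetP=> b /BP[n Nn ->]; apply/(AutFP _ _ sPS).
  split; first exact: Aut_Aut_isom.
  have [Sn nQn] := setIP Nn; have [c Fc Ec] := fhom_conjg F sQS Sn.
  have {}Fc : fhom F Q c.
    apply: fhom_widen Fc _ sQS; apply/subsetP=> _ /morphimP[u _ Qu ->].
    by rewrite Ec // memJ_norm.
  have [d Fd Ed] := fhom_compose Fphi' Fc.
  have [e Fe Ee] := fhom_compose Fd (fhom_onto Fphi).
  exists e => // _ /morphimP[u _ Qu ->].
  rewrite Aut_isomE ?Aut_aut // norm_conj_autE // Ee ?mem_morphim //=.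
  by rewrite Ed ?mem_morphim //= K1 // Ec.
have [x AFx sBx] := Sylow_Jsub (G := Group (AutF_group_set F sPS)) sylP sB pB.
case/(AutFP _ _ sPS): (AFx) => Ax [chi Fchi Echi].
have [alpha0 Falpha0 Ealpha0] := fhom_compose Fphi Fchi.
have im0 : alpha0 @* Q = phi @* Q.
  by apply/eqP; rewrite eqEcard (fhom_im Falpha0) !card_injm ?(fhom_injm Falpha0) ?leqnn.
have im0G : (alpha0 @* Q)%G = (phi @* Q)%G by apply: val_inj.
have fc0 : fully_centralized F (alpha0 @* Q)%G by rewrite im0G.
have [psi [Fpsi Epsi]] := satF.2 Q alpha0 (fhom_toS Falpha0) fc0.
(* For n in the normalizer of Q, the conjugate by x of the element of B given by n^-1
   is conjugation by some m; then m^-1 is the witness for n. *)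
have sNe : 'N_S(Q) \subset extender_group S alpha0.
  apply/subsetP=> n Nn; rewrite inE Nn /=.
  have Nn' : n^-1 \in 'N_S(Q) by rewrite groupV.
  pose b := Aut_isom inj (subxx Q) (conj_aut Q n^-1).
  have Bb : b \in B by apply/BP; exists n^-1.
  have /morphimP[m nPm Nm Em] : b ^ x \in AutS S (phi @* Q)%G.
    by rewrite (subsetP sBx) // memJ_conjg.
  have Nm' : m^-1 \in 'N_S(phi @* Q) by rewrite groupV.
  apply/exists_inP; exists m^-1; first by rewrite im0.
  apply/forall_inP=> u Qu.
  have Pu : phi u \in phi @* Q by rewrite mem_morphim.
  have Qun : u ^ n^-1 \in Q by rewrite memJ_norm //; case/setIP: Nn'.
  have conjV (z w : gT) : z * w * z^-1 = w ^ z^-1 by rewrite conjgE invgK mulgA.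
  rewrite !conjV invgK Ealpha0 //= Echi; last by rewrite mem_morphim.
  have -> : phi (u ^ n^-1) = b (phi u).
    by rewrite /b Aut_isomE ?Aut_aut // norm_conj_autE //; case/setIP: Nn'.
  rewrite -permJ Em Ealpha0 //= Echi //.
  by rewrite norm_conj_autE // Aut_closed.
have [alpha Falpha Ealpha] := fhom_restrict sNe Fpsi.
have sQN : Q \subset 'N_S(Q) by rewrite subsetI sQS normG.
exists alpha => //; rewrite /= -im0 morphimEdom; apply: eq_in_imset => u Qu.
by rewrite Ealpha ?(subsetP sQN) // Epsi.
Qed.

(** Let psi be the morphism with graph D. Take alpha from
    [extend_normalizer], and extend alpha o psi^-1, defined on psi(Q), to beta. If (y, x)
    normalizes D then conjugation by y on psi(Q) corresponds to conjugation by alpha(x) on P, so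
    that beta is defined at y. *)
Lemma normalizer_to_diag P Q D : fgraph F Q D -> fully_normalized F P -> fconj F Q P ->
  exists (A B : {group gT}) (alpha : {morphism A >-> gT}) (beta : {morphism B >-> gT}),
    [/\ fhom F S alpha, fhom F S beta, 'N_(setX S S)(D) \subset setX B A
      & pairm alpha beta @: D = diag P].
Proof.
move=> [psi Fpsi ->] fnP QP.
have [alpha Falpha imalpha] := extend_normalizer fnP QP.
have [sQS sPS] := fconj_sub QP; have spsiS := fhom_imS Fpsi.
have sQN : Q \subset 'N_S(Q) by rewrite subsetI sQS normG.
have [fcP _] := satF.1 P sPS fnP.
have [psi' [Fpsi' K1 K2 impsi']] := fhom_inverse Fpsi.
have [a Fa Ea] := fhom_restrict sQN Falpha.
have [gamma Fgamma Egamma] := fhom_compose Fpsi' Fa.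
have Gpsi u : u \in Q -> gamma (psi u) = alpha u.
  by move=> Qu; rewrite Egamma ?mem_morphim //= K1 // Ea.
have imgamma : (gamma @* (psi @* Q))%G = P.
  apply/val_inj; rewrite /= -imalpha (morphimEdom gamma) /=.
  apply/setP=> z; apply/imsetP/imsetP => [[_ /morphimP[u _ Qu ->] ->] | [u Qu ->]].
    by exists u; rewrite ?Gpsi.
  by exists (psi u); rewrite ?Gpsi ?mem_morphim.
have fcg : fully_centralized F (gamma @* (psi @* Q)%G)%G by rewrite imgamma.
have [beta [Fbeta Ebeta]] := satF.2 _ gamma Fgamma fcg.
exists ('N_S(Q))%G, (extender_group S gamma), alpha, beta; split=> //.
  apply/subsetP=> -[y x] Nyx; have /norm_graphP[Sy Sx Eyx] := Nyx.
  have /norm_graphP[_ _ Einv] : (y^-1, x^-1) \in 'N_(setX S S)(graph psi).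
    by rewrite (groupVr Nyx).
  have Nx : x \in 'N_S(Q).
    apply/setIP; split=> //; rewrite inE; apply/subsetP=> _ /imsetP[u Qu ->].
    by case: (Eyx u Qu).
  rewrite in_setX Nx andbT /=; apply/setIdP; split.
    apply/setIP; split=> //; rewrite inE; apply/subsetP=> _ /imsetP[_ /morphimP[u _ Qu ->] ->].
    by case: (Eyx u Qu) => Qux <-; rewrite mem_morphim.
  apply/exists_inP; exists (alpha x).
    have -> : gamma @* (psi @* Q)%G = P by rewrite -imgamma.
    apply/setIP; split.
      by rewrite (subsetP (fhom_imS Falpha)) ?mem_morphim.
    rewrite inE; apply/subsetP=> _ /imsetP[z Pz ->].
    move: Pz; rewrite -imalpha => /imsetP[u Qu ->].
    rewrite -(morphJ alpha (subsetP sQN _ Qu) Nx); apply: imset_f.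
    by case: (Eyx u Qu).
  apply/forall_inP=> _ /morphimP[u _ Qu ->].
  have [Quv Euv] := Einv u Qu.
  have -> : y * psi u * y^-1 = psi (u ^ x^-1) by rewrite Euv conjgE invgK mulgA.
  rewrite !Gpsi // conjgE invgK mulgA !morphM ?groupM ?(subsetP sQN u) ?groupV //.
  by rewrite morphV.
rewrite /graph -imset_comp -imalpha -imset_comp; apply: eq_in_imset => u Qu /=.
by rewrite /pairm /= Ebeta ?mem_morphim // Gpsi.
Qed.
End SaturatedCharacteristic.

(** * A characteristic element of a saturated fusion system *)

Section MarkConj.
Variables (gT hT : finGroupType) (G : {group gT}) (H : {group hT}) (p : nat).

Lemma mark_conj (v : burnside_loc G H p) (D : {set hT * gT}) c :
  D \subset setX H G -> c \in setX H G -> mark (D :^ c) v = mark D v.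
Proof.
move=> sD Kc; elim/burnside_loc_ind: v => [a u v IHu IHv | T X].
  by rewrite !mark_linear IHu IHv.
rewrite !mark_of; congr (_%:R)%R.
rewrite -[RHS](card_imset _ (act_inj (biset_action X) c)); apply: eq_card => y.
have act_in := actMin (biset_action X).
apply/afixP/imsetP => [Fy | [x /afixP Fx ->] _ /imsetP[d Dd ->]]; last first.
  have Kd := subsetP sD _ Dd.
  by rewrite -act_in ?groupJ // conjgE mulKVg act_in // Fx.
exists (biset_action X y c^-1); last by rewrite actKVin.
apply/afixP=> d Dd; have Kd := subsetP sD _ Dd.
rewrite -act_in ?groupV // -{2}(Fy (d ^ c)) ?memJ_conjg //.
by rewrite -act_in ?groupJ ?groupV // conjgE !mulgA mulgK.
Qed.

Lemma mark_gen (v : burnside_loc G H p) (D : {set hT * gT}) :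
  D \subset setX H G -> mark <<D>> v = mark D v.
Proof.
move=> sD; elim/burnside_loc_ind: v => [a u v IHu IHv | T X].
  by rewrite !mark_linear IHu IHv.
by rewrite !mark_of /bfix afix_gen_in.
Qed.
End MarkConj.

Section Stabilize.
Variables (gT : finGroupType) (S : {group gT}) (F : fusion_system S) (p : nat).
Hypotheses (p_pr : prime p) (pS : p.-group S) (satF : saturated F p).
Implicit Types P Q R : {group gT}.

(** Compare the Cauchy-Frobenius congruences for the action of N = N(D) on the fixed
    points of D, and of its image nu(N) on those of the diagonal of P = nu(Q). A term indexed by n
    outside D is a mark at the subgroup generated by D and n. This is larger than D, so by
    hypothesis it equals the mark at its image under nu, and only the terms with n in D are left
    in the difference. *)
Lemma mark_congruence (v : burnside_loc S S p) P Q D :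
    fgenerated F v -> class_marks_ge F #|Q|.+1 v ->
    fgraph F Q D -> fully_normalized F P -> fconj F Q P ->
  Zdvd #|'N_(setX S S)(D)| (#|D|%:R * (mark D v - mark (diag P) v))%R.
Proof.
move=> Fv clv gD fnP QP.
have [A [B [alpha [beta [Fa Fb sN imD]]]]] := normalizer_to_diag pS satF gD fnP QP.
pose N := ('N_(setX S S)(D))%G; pose nu := pairm_morphism alpha beta.
have inj : 'injm nu by apply: injm_pairm; [apply: fhom_injm Fa | apply: fhom_injm Fb].
have nuI : {in N &, injective nu}.
  by move=> c d Nc Nd; apply: (injmP inj); apply: (subsetP sN).
have [phi Fphi ED] := gD.
have gsD : group_set D by rewrite ED groupP.
have sDS := fgraph_sub gD.
have sDN : D \subset N by rewrite subsetI sDS (normG (Group gsD)).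
have sNS : N \subset setX S S by apply: subsetIl.
have sABS : setX B A \subset setX S S.
  by apply: setXS; [apply: fhom_subl Fb | apply: fhom_subl Fa].
have imN : nu @* N = nu @: N by rewrite morphimEsub.
have imD' : nu @* D = diag P by rewrite morphimEsub ?(subset_trans sDN).
have sNuS : nu @* N \subset setX S S.
  apply/subsetP=> _ /morphimP[[h u] /setXP[Bh Au] _ ->]; rewrite inE /=.
  by rewrite (subsetP (fhom_imS Fb)) ?(subsetP (fhom_imS Fa)) ?mem_morphim.
have cN : #|nu @* N| = #|N| by rewrite card_injm.
have sPS : P \subset S by case: (fconj_sub QP).
have [y1 E1] : Zdvd #|N| (\sum_(n in N) mark (D :|: [set n]) v)%R.
  by apply: mark_Cauchy_Frobenius; rewrite ?subsetIr.
have [y2 E2] : Zdvd #|N| (\sum_(n in N) mark (diag P :|: [set nu n]) v)%R.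
  have -> : (\sum_(n in N) mark (diag P :|: [set nu n]) v =
             \sum_(m in nu @* N) mark (diag P :|: [set m]) v)%R.
    by rewrite imN big_imset.
  rewrite -cN; apply: (@mark_Cauchy_Frobenius _ _ _ _ _ _ (nu @* N)%G) => //.
    exact: fgraph_sub (diag_fgraph F sPS).
  by rewrite -imD'; apply: morphim_norms; apply: subsetIr.
exists (y1 - y2)%R; transitivity (#|N|%:R * y1 - #|N|%:R * y2)%R; last by rewrite mulrBr.
rewrite -E1 -E2 -sumrB.
rewrite [RHS](bigID (mem D)) /= [X in _ = (_ + X)%R]big1 ?addr0.
  rewrite (eq_bigl (mem D)); last first.
    by move=> n /=; apply: andb_idl; apply: (subsetP sDN).
  rewrite (eq_bigr (fun=> mark D v - mark (diag P) v)%R) ?sumr_const ?mulr_natl // => n Dn.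
  have nuDn : nu n \in diag P by rewrite -imD' mem_morphim // (subsetP sN) ?(subsetP sDN).
  have absorb (E : {set gT * gT}) m : m \in E -> E :|: [set m] = E.
    by move=> Em; apply/setUidPl; rewrite sub1set.
  by rewrite !absorb.
move=> n /andP[Nn nDn].
have sL : D :|: [set n] \subset N by rewrite subUset sDN sub1set.
have sLBA := subset_trans sL sN.
have sgL : <<D :|: [set n]>> \subset setX B A by rewrite gen_subG.
have nuL : diag P :|: [set nu n] = nu @* (D :|: [set n]).
  by rewrite morphimU imD' morphim_set1 // (subsetP sN).
rewrite nuL -(mark_gen v (subset_trans sLBA sABS)) -[in X in (_ - X)%R]mark_gen; last first.
  by apply: subset_trans (morphimS _ sL) sNuS.
rewrite -morphim_gen // morphimEsub //.
rewrite [X in (_ - X)%R](mark_map Fv clv sgL Fa Fb) ?subrr //.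
rewrite -(fgraph_card gD); apply: proper_card; apply/properP; split.
  by apply: subset_trans (subset_gen _); apply: subsetUl.
by exists n => //; apply: mem_gen; rewrite !inE eqxx orbT.
Qed.

(** A choice of a fully normalized representative that depends only on the F-conjugacy
    class of Q. *)
Definition fnrep Q : {group gT} :=
  odflt Q [pick P | `[< fconj F Q P /\ fully_normalized F P >]].

Lemma fnrepP Q : Q \subset S -> fconj F Q (fnrep Q) /\ fully_normalized F (fnrep Q).
Proof.
move=> sQS; rewrite /fnrep; case: pickP => [P /asboolP[] // | none].
have [P QP fnP] := ex_fully_normalized F sQS.
by have /asboolP[] := none P.
Qed.

Lemma fnrep_fconj Q R : fconj F Q R -> fnrep Q = fnrep R.
Proof.
move=> QR; have [sQS sRS] := fconj_sub QR.
have E : (fun P => `[< fconj F Q P /\ fully_normalized F P >]) =1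
         (fun P => `[< fconj F R P /\ fully_normalized F P >]).
  move=> P; apply/asboolP/asboolP => -[QP fnP]; split=> //.
    exact: fconj_trans (fconj_sym QR) QP.
  exact: fconj_trans QR QP.
rewrite /fnrep (eq_pick E); case: pickP => // none.
have [P RP fnP] := ex_fully_normalized F sRS.
by have /asboolP[] := none P.
Qed.

Lemma fconj_whole P : fconj F S P -> P = S.
Proof.
move=> SP; have [_ sPS] := fconj_sub SP.
by apply/val_inj/eqP; rewrite /= eqEcard sPS (fconj_card SP) leqnn.
Qed.

Lemma fnrep_whole : fnrep S = S.
Proof. exact: fconj_whole (proj1 (fnrepP (subxx S))). Qed.

(** Adding multiples of [P, phi] leaves other classes alone: among the subgroups
    which are at least as large as Delta(P, phi), only its conjugates fix a point of
    [P, phi]. *)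
Lemma mark_tr_above P (phi : {morphism P >-> gT}) (E : {group gT * gT}) :
    fhom F S phi -> E \subset setX S S -> (#|P| <= #|E|)%N ->
    mark E (bloc_tr S S p phi) != 0%R ->
  exists2 c, c \in setX S S & E :^ c = graph phi.
Proof.
move=> Fphi sES le; rewrite mark_of => nz.
have [|c Kc sEc] := bfix_tr_conj (fhom_imS Fphi) sES.
  by apply: contraNneq nz => ->; rewrite cards0.
exists c => //; apply/eqP; rewrite eqEcard sEc cardJg card_graph; exact: le.
Qed.

(** The mark of [D] at D is #|N(D)| / #|D|, so [mark_congruence] says that a multiple
    of [D] corrects the mark at D. The correction changes no mark that was already right: such a
    mark at a conjugate of D would make the mark at D right. *)
Lemma stabilize_one (v : burnside_loc S S p) Q D :
    fgenerated F v -> class_marks_ge F #|Q|.+1 v -> fgraph F Q D ->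
    mark D v != mark (diag (fnrep Q)) v ->
  exists w, [/\ fgenerated F w, mark D w = mark (diag (fnrep Q)) w,
    forall R, R \subset S -> (#|Q| <= #|R|)%N -> mark (diag (fnrep R)) w = mark (diag (fnrep R)) v
  & forall R E, fgraph F R E -> (#|Q| <= #|R|)%N ->
      mark E v = mark (diag (fnrep R)) v -> mark E w = mark E v].
Proof.
move=> Fv clv gD bad; have [phi Fphi ED] := gD.
have sQS := fhom_subl Fphi.
have [QP fnP] := fnrepP sQS.
have [y Ey] := mark_congruence Fv clv gD fnP QP.
pose w := ((- y) *: bloc_tr S S p phi + v)%R.
have keep R E : fgraph F R E -> (#|Q| <= #|R|)%N ->
    mark E v = mark (diag (fnrep R)) v -> mark E w = mark E v.
  move=> gE le good; rewrite mark_linear.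
  have [->|nz] := eqVneq (mark E (bloc_tr S S p phi)) 0%R; first by rewrite mulr0 add0r.
  have [psi Fpsi EE] := gE; case/eqP: bad.
  have [] := @mark_tr_above _ phi (graph_group psi) Fphi.
  - by rewrite /= -EE; apply: fgraph_sub gE.
  - by rewrite card_graph.
  - by rewrite /= -EE.
  move=> c Kc /=; rewrite -EE -ED => Ec.
  rewrite -Ec mark_conj ?(fgraph_sub gE) // good.
  have [R' RR' gR'] := fgraph_conj gE Kc.
  have -> : Q = R' by apply: (fgraph_dom gD); rewrite -Ec.
  by rewrite (fnrep_fconj RR').
have keepr R : R \subset S -> (#|Q| <= #|R|)%N ->
    mark (diag (fnrep R)) w = mark (diag (fnrep R)) v.
  move=> sRS le; have [RR' _] := fnrepP sRS; have [_ sR'S] := fconj_sub RR'.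
  apply: (keep (fnrep R) _ (diag_fgraph F sR'S)); first by rewrite -(fconj_card RR').
  by rewrite -(fnrep_fconj RR').
exists w; split=> //.
  apply: in_spanD => //; apply: in_spanZ; apply: in_span_gen.
  by exists Q, phi.
rewrite keepr //.
have D0 : (0 < #|D|)%N by rewrite (fgraph_card gD).
rewrite mulrBr in Ey; apply: (Zlocal_mulnI D0); rewrite mark_linear mulrDr.
have Et : (#|D|%:R * mark D (bloc_tr S S p phi))%R = #|'N_(setX S S)(D)|%:R%R :> Zlocal p.
  rewrite mark_of ED -natrM mulnC -(card_bfix_tr (H := S) (phi := phi)) //.
  exact: fhom_imS Fphi.
by rewrite mulNr mulrN mulrCA Et mulrC -Ey addrC opprB addrC subrK.
Qed.

(** Correct the graphs over subgroups of order k one after the other. *)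
Lemma stabilize_level k (v : burnside_loc S S p) (s : seq {set gT * gT}) :
    fgenerated F v -> class_marks_ge F k.+1 v -> (k <= #|S|)%N ->
  exists w, [/\ fgenerated F w, class_marks_ge F k.+1 w,
    mark (diag S) w = mark (diag S) v &
    forall Q D, D \in s -> fgraph F Q D -> #|Q| = k -> mark D w = mark (diag (fnrep Q)) w].
Proof.
move=> Fv clv kS; elim: s => [|D s [w [Fw clw mw sw]]]; first by exists v.
have [[Q [gD cQ bad]] | good] := pselect (exists Q, [/\ fgraph F Q D, #|Q| = k
     & mark D w != mark (diag (fnrep Q)) w]); last first.
  exists w; split=> // Q E; rewrite inE => /predU1P[-> | sE] gD cQ; last exact: sw.
  by apply/eqP/negP => /negP bad; apply: good; exists Q.
subst k; have [u [Fu mu keepr keep]] := stabilize_one Fw clw gD bad.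
(* Above order k the marks already agree on classes. *)
have rep R E : fgraph F R E -> (#|Q| < #|R|)%N -> mark E w = mark (diag (fnrep R)) w.
  move=> gE lt; have sRS : R \subset S by case: gE => psi /fhom_subl.
  have [RR' _] := fnrepP sRS; have [_ sR'S] := fconj_sub RR'.
  exact: (clw _ _ _ _ gE (diag_fgraph F sR'S) RR').
exists u; split=> //.
- move=> R R' E E' gE gE' RR' lt.
  have lt' : (#|Q| < #|R'|)%N by rewrite -(fconj_card RR').
  rewrite (keep R E gE (ltnW lt) (rep R E gE lt)) (rep R E gE lt).
  rewrite (keep R' E' gE' (ltnW lt') (rep R' E' gE' lt')) (rep R' E' gE' lt').
  by rewrite (fnrep_fconj RR').
- by rewrite -mw; have := keepr S (subxx S) kS; rewrite fnrep_whole.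
- move=> R E; rewrite inE => /predU1P[-> gE cR | sE gE cR].
    by rewrite (fgraph_dom gE gD).
  have sRS : R \subset S by case: gE => psi /fhom_subl.
  by rewrite (keep R) ?cR // ?keepr ?cR //; apply: sw.
Qed.

(** Downward induction on the order of the domains; the mark at the diagonal of S
    is never corrected, S being its own representative. *)
Lemma ex_class_marks (v : burnside_loc S S p) : fgenerated F v ->
    class_marks_ge F #|S|.+1 v ->
  exists w, [/\ fgenerated F w, class_marks F w & mark (diag S) w = mark (diag S) v].
Proof.
move=> Fv clv; suff down j : (j <= #|S|.+1)%N -> exists w,
    [/\ fgenerated F w, class_marks_ge F (#|S|.+1 - j) w & mark (diag S) w = mark (diag S) v].
  by have [|w []] := down #|S|.+1 => //; rewrite subnn; exists w.
elim: j => [_|j IHj lej]; first by exists v; rewrite subn0.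
have [w [Fw clw mw]] := IHj (ltnW lej).
rewrite subSS; rewrite ltnS in lej.
have Ek : (#|S|.+1 - j)%N = (#|S| - j).+1 by rewrite subSn.
rewrite Ek in clw.
have [u [Fu clu mu su]] := stabilize_level (enum {set gT * gT}) Fw clw (leq_subr _ _).
exists u; split=> //; last by rewrite mu.
move=> Q R D E gD gE QR; rewrite leq_eqVlt => /predU1P[cQ | lt]; last first.
  exact: (clu _ _ _ _ gD gE QR lt).
rewrite (su Q D) ?mem_enum // (su R E) ?mem_enum // ?(fnrep_fconj QR) //.
by rewrite -(fconj_card QR).
Qed.

(** Start the stabilization with [S, id], whose mark at the diagonal is
    #|'C_S(S)|. By [augmentation_class] for P = S, the augmentation of the result is congruent
    modulo p to #|AutF F S| #|'C_S(S)| / #|S|, the index of Aut_S(S) in Aut_F(S), which is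
    prime to p because S is fully normalized. *)
Lemma saturated_characteristic : exists Omega : burnside_loc S S p, characteristic_element F Omega.
Proof.
have FS := fhom_toS (fhom_id F (subxx S)).
pose v := bloc_tr S S p (idm_morphism S).
have Fv : fgenerated F v by apply: in_span_gen; exists S, (idm_morphism S).
have clv : class_marks_ge F #|S|.+1 v.
  move=> Q R D E gD _ _; have sQS : Q \subset S by case: gD => psi /fhom_subl.
  by rewrite ltnNge subset_leq_card.
have [w [Fw clw mw]] := ex_class_marks Fv clv.
exists w; split=> //; [exact: class_marks_left | exact: class_marks_right |].
have fnS : fully_normalized F S by move=> P /fconj_whole->.
have [_ sylS] := satF.1 S (subxx S) fnS.
have cfS : #|fclass F S| = 1%N.
  apply/eqP/cards1P; exists S; apply/setP=> P; rewrite [RHS]in_set1.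
  apply/fclassP/eqP => [/fconj_whole-> // | ->]; exact: fconj_refl.
have [t Et pt] : exists2 t, (#|AutF F S| = #|AutS S S| * t)%N & ~~ (p %| t)%N.
  have gAutS : group_set (AutS S S) by rewrite /AutS groupP.
  have gAutF := AutF_group_set F (subxx S).
  have /and3P[sAut _ p't] := sylS.
  exists #|AutF F S : AutS S S|; last by rewrite -p'natE.
  by rewrite (@Lagrange _ (Group gAutF) (Group gAutS)).
have mS : mark (diag S) w = #|'C_S(S)|%:R%R.
  have imS : idm_morphism S @* S = S by apply: morphim_idm.
  have extS : extender S (idm_morphism S) = S :> {set gT}.
    apply/setP=> x; apply/setIdP/idP => [[/setIP[]] // | Sx].
    have Nx : x \in 'N_S(S) by rewrite inE Sx (subsetP (normG S)).
    split=> //; apply/exists_inP; exists x; first by rewrite imS.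
    by apply/forall_inP.
  rewrite mw mark_of; congr (_%:R)%R; apply/eqP.
  rewrite -(eqn_pmul2r (cardG_gt0 S)) -{1}(card_graph (idm_morphism S)).
  rewrite card_bfix_tr ?imS //.
  have [_ _ ->] := card_norm_graph (phi := idm_morphism S) (subxx S) (fhom_imS FS).
  by rewrite extS imS mulnC.
have := augmentation_class p_pr pS Fw clw (subxx S).
rewrite card_fgraphs // cfS mul1n mS -natrM Et mulnAC -card_AutS.
rewrite (setIidPl (normG S)) natrM -mulrBr => -[y Ey] [z Ez].
have {Ey}Ey : (augmentation w - t%:R = p%:R * y)%R.
  by apply: (Zlocal_mulnI (cardG_gt0 S)); rewrite Ey natrM mulrCA mulrA.
case/negP: pt; apply: (@Zdvd_natp p); exists (z - y)%R.
by rewrite mulrBr -Ez -Ey opprB addrC subrK.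
Qed.

End Stabilize.

Theorem theorem1 (gT : finGroupType) (S : {group gT}) (p : nat)
    (F : fusion_system S) (p_prime : prime p) (pS : (p.-group S)%g) :
  saturated F p <->
  exists Omega : burnside_loc S S p, characteristic_element F Omega.
Proof.
split=> [satF | [Omega [Fgen lst rst aug]]].
  exact: saturated_characteristic.
have cl := stable_class_marks lst rst; split=> [P sPS | P phi].
  exact: (characteristic_Sylow p_prime pS Fgen cl aug sPS).
exact: (characteristic_extension p_prime pS Fgen cl aug).
Qed.
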